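(* Let $\Omega=\mathbb{R}^n$, $p\ge1$, let $f$ satisfy the standing assumptions and in addition $f\in C^2((0,+\infty))$, with $k=(f')^{-1}$, and let $g:[0,1]\to[0,+\infty)$ be subadditive, lower semicontinuous, with $g(0)=0$, $\lim_{t\to0^+}g(t)/t=+\infty$, and $g\in C^2((0,1])\cap C^0([0,1])$. Suppose that $$\limsup_{R\to0^+}\ g''\!\left(\int_0^R k(R^p-r^p)\,n\omega_n r^{n-1}\,dr\right)\int_0^R k'(R^p-r^p)\,n\omega_n r^{n-1}\,dr<-1,$$ where $\omega_n$ is the volume of the unit ball in $\mathbb{R}^n$. Then the minimization problem for $\mathfrak{F}^p$ over $\mathcal{W}_p(\mathbb{R}^n)\times\mathcal{W}_p(\mathbb{R}^n)$ has a solution.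
   Context: Standing assumptions on $f$: $f:[0,+\infty)\to[0,+\infty)$ is strictly convex and $C^1$, $f(0)=0$, $f'(0)=0$, and $\lim_{t\to+\infty}f(t)/t=+\infty$; $k=(f')^{-1}:[0,+\infty)\to[0,+\infty)$, and $k'$ denotes its derivative on $(0,+\infty)$. $\mathcal{W}_p(\mathbb{R}^n)=\{\lambda\in\mathcal{P}(\mathbb{R}^n):\int|x|^p\,d\lambda<+\infty\}$. $T_p(\mu,\nu)=\inf_\gamma\int|x-y|^p\,d\gamma$ over transport plans. $F(\mu)=\int f(u)\,dx$ if $\mu=u\cdot\mathcal{L}^n$, $+\infty$ otherwise. $G(\nu)=\sum_i g(a_i)$ if $\nu=\sum_{i}a_i\delta_{x_i}$ is purely atomic (distinct $x_i$), $+\infty$ otherwise. $\mathfrak{F}^p(\mu,\nu)=T_p(\mu,\nu)+F(\mu)+G(\nu)$. *)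

(* Defs.v *)
From HB Require Import structures.
From mathcomp Require Import all_boot all_order all_algebra.
From mathcomp Require Import all_classical all_reals all_analysis.
Set Implicit Arguments. Unset Strict Implicit. Unset Printing Implicit Defensive.
Import Order.TTheory GRing.Theory Num.Theory.
Import numFieldNormedType.Exports.
Local Open Scope classical_set_scope.
Local Open Scope ring_scope.

Section defs.
Variables (R : realType) (n : nat).

(* R^n is modelled as n.-tuple R with the product Borel sigma-algebra. *)
Notation Rn := (n.-tuple R).

Definition enorm (x : Rn) : R := Num.sqrt (\sum_(i < n) (tnth x i) ^+ 2).
Definition edist (x y : Rn) : R :=
  Num.sqrt (\sum_(i < n) (tnth x i - tnth y i) ^+ 2).

Definition box (a b : Rn) : set Rn :=
  [set x | forall i : 'I_n, tnth a i <= tnth x i <= tnth b i].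

(* lam is the n-dimensional Lebesgue measure (on Borel sets of R^n):
   it gives every box its euclidean volume (this determines it uniquely) *)
Definition is_lebesgue_n (lam : {measure set Rn -> \bar R}) : Prop :=
  forall a b : Rn, (forall i : 'I_n, tnth a i <= tnth b i) ->
    lam (box a b) = (\prod_(i < n) (tnth b i - tnth a i))%:E.

Definition omega (lam : {measure set Rn -> \bar R}) : R :=
  fine (lam [set x | enorm x <= 1]).

Definition Wp (p : R) (mu : probability Rn R) : Prop :=
  (\int[mu]_x ((enorm x) `^ p)%:E < +oo)%E.

Definition transport_plan (mu nu : probability Rn R)
    (gam : probability (Rn * Rn)%type R) : Prop :=
  (forall A, measurable A -> gam (A `*` setT) = mu A) /\
  (forall B, measurable B -> gam (setT `*` B) = nu B).

Definition Tp (p : R) (mu nu : probability Rn R) : \bar R :=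
  ereal_inf [set (\int[gam]_z ((edist z.1 z.2) `^ p)%:E)%E
            | gam in transport_plan mu nu].

Definition is_density (lam : {measure set Rn -> \bar R}) (mu : probability Rn R)
    (u : Rn -> R) : Prop :=
  measurable_fun setT u /\ (forall x, 0 <= u x) /\
  (forall A, measurable A -> mu A = (\int[lam]_(x in A) (u x)%:E)%E).

(* F(mu) = int f(u) dx if mu = u L^n, +oo otherwise (the value does not
   depend on the choice of the density, all densities agree a.e.) *)
Definition Ffun (lam : {measure set Rn -> \bar R}) (f : R -> R)
    (mu : probability Rn R) : \bar R :=
  ereal_inf [set (\int[lam]_x (f (u x))%:E)%E | u in is_density lam mu].

(* nu = sum_i a_i delta_{x_i} with distinct x_i (countably many atoms;
   finitely many atoms are covered by zero weights) *)
Definition atomic_decomp (nu : probability Rn R) (a : nat -> R)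
    (x : nat -> Rn) : Prop :=
  (forall i, 0 <= a i) /\ injective x /\
  (forall A, measurable A -> nu A = (\sum_(i <oo) (a i)%:E * \d_(x i) A)%E).

(* G(nu) = sum_i g(a_i) if nu is purely atomic, +oo otherwise *)
Definition Gfun (g : R -> R) (nu : probability Rn R) : \bar R :=
  ereal_inf [set (\sum_(i <oo) (g (ax.1 i))%:E)%E
            | ax in [set ax : (nat -> R) * (nat -> Rn) |
                     atomic_decomp nu ax.1 ax.2]].

Definition frakF (lam : {measure set Rn -> \bar R}) (f g : R -> R) (p : R)
    (mu nu : probability Rn R) : \bar R :=
  (Tp p mu nu + Ffun lam f mu + Gfun g nu)%E.

End defs.

Section hyps.
Variable R : realType.

Definition standing_f (f : R -> R) : Prop :=
  (forall t, 0 <= t -> 0 <= f t) /\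
  (forall x y t, 0 <= x -> 0 <= y -> x != y -> 0 < t < 1 ->
     f (t * x + (1 - t) * y) < t * f x + (1 - t) * f y) /\
  (* C^1 on [0,+oo) (right derivative at 0) with f(0) = 0 and f'(0) = 0 *)
  (forall x, 0 < x -> derivable f x 1) /\
  {in `]0, +oo[, continuous (derive1 f)} /\
  f 0 = 0 /\
  ((fun h => f h / h) @ 0^'+ --> 0) /\
  (derive1 f @ 0^'+ --> 0) /\
  ((fun t => f t / t) @ +oo --> +oo).

Definition C2_pos (f : R -> R) : Prop :=
  (forall x, 0 < x -> derivable f x 1 /\ derivable (derive1 f) x 1) /\
  {in `]0, +oo[, continuous (derive1n 2 f)}.

(* k = (f')^{-1} : [0,+oo) -> [0,+oo), where f'(0) = 0 *)
Definition is_inv_deriv (f k : R -> R) : Prop :=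
  k 0 = 0 /\ (forall t, 0 < t -> 0 < k t /\ derive1 f (k t) = t).

Definition hyp_g (g : R -> R) : Prop :=
  (forall t, 0 <= t <= 1 -> 0 <= g t) /\
  (forall a b, 0 <= a -> 0 <= b -> a + b <= 1 -> g (a + b) <= g a + g b) /\
  (forall x : R, 0 <= x <= 1 -> forall e : R, 0 < e ->
     \forall y \near x, 0 <= y <= 1 -> g x - e < g y) /\
  g 0 = 0 /\
  ((fun t => g t / t) @ 0^'+ --> +oo) /\
  {within `[0, 1], continuous g} /\
  (forall x, 0 < x <= 1 -> derivable g x 1 /\ derivable (derive1 g) x 1) /\
  {within `]0, 1], continuous (derive1n 2 g)}.

Definition radial_int (n : nat) (om p : R) (h : R -> R) (Rad : R) : \bar R :=
  (\int[lebesgue_measure]_(r in `[0%R, Rad])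
     (h (Rad `^ p - r `^ p) * (n%:R * om * r ^+ n.-1))%:E)%E.

End hyps.

(* Main.v *)
(** Write [phi a] for the least value of [int |x|^p u + f(u)] among densities
    [u] of mass [a].  It is attained at [u = k((c - |x|^p)_+)], where the level
    [c] is fixed by the mass [A(c) = int k((c - |x|^p)_+)] being [a], and there
    [phi a = c a - B(c)], [B(c)] being the integral of the Legendre transform
    of [f] at [(c - |x|^p)_+].

    Lower bound.  For a plan between [u] and [sum_i a_i delta_(x_i)] and levels
    [c_i = A^-1(a_i)], the function [s(x) = max_i (c_i - |x - x_i|^p)_+] is
    admissible in the dual problem, and Young's inequality [s u <= f(u) + f*(s)]
    gives [T_p + F >= sum_i phi(a_i)].  Hence the energy is at least
    [sum_i h(a_i)] with [h = phi + g].

    Concavity.  [phi' = A^-1], so [h' o A = c + g'(A(c))].  Fatou's lemma bounds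
    the lower right Dini derivative of [A] from below by [int k'], so the
    hypothesis makes [c + g'(A(c))] decreasing for small [c]: [h] is concave
    near [0], hence subadditive there.  Merging small atoms thus never increases
    [sum_i h(a_i)], which reduces the problem to a bounded number of atoms,
    where compactness of the simplex gives an optimal family [(a_i)].

    Finally, putting the optimal profiles of masses [a_i] around centres far
    from each other produces a pair whose energy is exactly [sum_i h(a_i)]. *)

Require Import Defs.
From HB Require Import structures.
From mathcomp Require Import all_boot all_order all_algebra.
From mathcomp Require Import all_classical all_reals all_analysis.
From mathcomp Require Import measurable_realfun ring lra.
(* MathComp-Analysis also has a (different) [edist]. *)
Import Defs.
Set Implicit Arguments. Unset Strict Implicit. Unset Printing Implicit Defensive.
Import Order.TTheory GRing.Theory Num.Theory.
Import numFieldNormedType.Exports.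
Local Open Scope classical_set_scope.
Local Open Scope ring_scope.

(** The optimal profile of a given mass costs the same around every centre, so the problem over
    pairs of measures collapses to one over sequences of numbers. Three obstacles shape the
    argument. The second derivative of [f] may vanish, so [k] can fail to be differentiable, and
    [derive1 k] is then the default value [0]; its integral therefore bounds the growth of the mass
    function only from below. One bound is enough because the hypothesis forces the second
    derivative of [g] to be negative: a faster growing mass only makes [derive1 g] drop faster.
    Next, the mass function may have no derivative, so the slope of [phi + g] is not differentiated:
    it is shown to drop along arbitrarily small steps to the right of each level, and continuity
    turns this into monotonicity. Finally, merging handles finite lists, while the atoms may be
    infinitely many: their tail is replaced by one small atom whose cost tends to [0]. Duality
    enters only as an inequality; for the constructed pair Young's inequality is an equality at
    every point, which is checked by direct computation. *)

Section integral_lemmas.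
Context d (T : measurableType d) (R : realType).
Local Open Scope ereal_scope.
Import HBNNSimple.

(* Unlike [ge0_le_integral], this applies to [derive1 k], whose measurability is
   not known. *)
Lemma ge0_le_integral_nomeas (mu : {measure set T -> \bar R}) (D : set T)
    (f1 f2 : T -> \bar R) :
  (forall x, D x -> 0 <= f1 x) -> (forall x, D x -> f1 x <= f2 x) ->
  \int[mu]_(x in D) f1 x <= \int[mu]_(x in D) f2 x.
Proof.
move=> f10 f12; rewrite !ge0_integralE//; last first.
  by move=> x Dx; exact: le_trans (f10 _ Dx) (f12 _ Dx).
apply: le_ereal_sup => _ [h hf <-]; exists h => // x.
by apply: (le_trans (hf x)); exact: lee_restrict.
Qed.

(** The proofs are arguments so that the measure structure declared below can be inferred from the
    term alone. *)
Definition mdensity (mu : {measure set T -> \bar R}) (u : T -> R)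
    (meas_u : measurable_fun setT u) (u0 : forall x, (0 <= u x)%R) :
    set T -> \bar R :=
  fun A => \int[mu]_(x in A) (u x)%:E.

Section mdensity_measure.
Variables (mu : {measure set T -> \bar R}) (u : T -> R).
Hypotheses (meas_u : measurable_fun setT u) (u0 : forall x, (0 <= u x)%R).

Let md := mdensity mu meas_u u0.

Let mdensity0 : md set0 = 0.
Proof. by rewrite /md /mdensity integral_set0. Qed.

Let mdensity_ge0 A : 0 <= md A.
Proof. by apply: integral_ge0 => x _; rewrite lee_fin. Qed.

Let mdensity_sigma_additive : semi_sigma_additive md.
Proof.
move=> /= A mA tA mUA.
rewrite /md /mdensity ge0_integral_bigcup//=; last 2 first.
  by apply/measurable_EFinP; exact: measurable_funTS.
  by move=> x _; rewrite lee_fin.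
apply: is_cvg_ereal_nneg_natsum_cond => n _ _.
by apply: integral_ge0 => /= x ?; rewrite lee_fin.
Qed.

HB.instance Definition _ := isMeasure.Build _ _ _
  (mdensity mu meas_u u0) mdensity0 mdensity_ge0 mdensity_sigma_additive.

End mdensity_measure.

(** On simple functions this is [mE] on each level set; monotone convergence does the rest. The
    measure [m] is arbitrary, since both [mdensity] and given measures with a density occur
    later. *)
Lemma ge0_integral_density (mu m : {measure set T -> \bar R}) (u : T -> R)
    (f : T -> \bar R) :
  measurable_fun setT u -> (forall x, (0 <= u x)%R) ->
  (forall A, measurable A -> m A = \int[mu]_(x in A) (u x)%:E) ->
  measurable_fun setT f -> (forall x, 0 <= f x) ->
  \int[m]_x f x = \int[mu]_x (f x * (u x)%:E).
Proof.
move=> meas_u u0 mE mf f0.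
have mD : measurable [set: T] by [].
have muE : measurable_fun setT (EFin \o u) by exact/measurable_EFinP.
pose f_ := nnsfun_approx mD mf.
transitivity (limn (fun n => \int[m]_x (f_ n x)%:E)).
  rewrite -monotone_convergence//.
  - apply: eq_integral => y _; apply/esym/cvg_lim => //.
    by apply: cvg_nnsfun_approx => // *.
  - by move=> n; exact/measurable_EFinP/measurable_funP.
  - by move=> n y _; rewrite lee_fin.
  - by move=> y _ a b ab; rewrite lee_fin; exact/lefP/nd_nnsfun_approx.
rewrite [X in limn X](_ : _ = (fun n => \int[mu]_x ((f_ n x)%:E * (u x)%:E))).
  rewrite -monotone_convergence//; last 3 first.
  - move=> n; apply: emeasurable_funM => //.
    exact/measurable_EFinP/measurable_funP.
  - by move=> n x _ /=; rewrite -EFinM lee_fin mulr_ge0.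
  - move=> x _ a b ab; rewrite -!EFinM lee_fin ler_wpM2r//.
    exact/lefP/nd_nnsfun_approx.
  apply: eq_integral => x _ /=; apply/cvg_lim => //.
  by apply: cvgeZr => //; exact: cvg_nnsfun_approx.
apply/funext => n.
under eq_integral do rewrite fimfunE -fsumEFin//.
rewrite ge0_integral_fsum//; last 2 first.
- by move=> r; exact/measurable_EFinP/measurableT_comp.
- by move=> r x _; rewrite nnfun_muleindic_ge0.
under [RHS]eq_integral.
  move=> x _; rewrite fimfunE -fsumEFin// muleC ge0_mule_fsumr; last first.
    by move=> r; rewrite EFinM nnfun_muleindic_ge0.
  over.
rewrite [RHS]ge0_integral_fsum//; last 2 first.
- move=> r; apply: emeasurable_funM => //.
  by apply/measurable_EFinP; do 2 apply/measurableT_comp => //.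
- move=> r x _; apply: mule_ge0; first by rewrite lee_fin.
  by rewrite EFinM nnfun_muleindic_ge0.
apply: eq_fsbigr => r rf.
have r0 : (0 <= r)%R by move: rf; rewrite inE => -[x _ <-].
have mr : measurable (f_ n @^-1` [set r]).
  by rewrite -[X in measurable X]setTI; apply: (measurable_funP (f_ n)).
rewrite integralZl_indic_nnsfun// integral_indic// setIT mE//.
rewrite integral_mkcond -ge0_integralZl//; last 2 first.
- by apply/(measurable_restrictT _ _).1 => //; exact: measurable_funTS.
- by move=> x _; apply: erestrict_ge0 => y _; rewrite lee_fin.
apply: eq_integral => x _; rewrite patchE.
rewrite EFinM muleCA; congr (_ * _); rewrite indicE.
by case: ifP => _; rewrite ?mule1 ?mule0.
Qed.

End integral_lemmas.
Section pushforward_lemmas.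
Context d d' (T : measurableType d) (U : measurableType d') (R : realType).

Definition mpush (mu : {measure set T -> \bar R}) (f : T -> U)
  (mf : measurable_fun setT f) : {measure set U -> \bar R}.
Proof. by refine (pushforward mu f); exact: mf. Defined.

Lemma ge0_integral_mpush (mu : {measure set T -> \bar R}) (f : T -> U)
    (mf : measurable_fun setT f) (h : U -> \bar R) :
  measurable_fun setT h -> (forall y, (0 <= h y)%E) ->
  (\int[mpush mu mf]_y h y = \int[mu]_x h (f x))%E.
Proof. by move=> mh h0; rewrite ge0_integral_pushforward. Qed.

End pushforward_lemmas.

(** * Lebesgue measure on [R^n] in radial coordinates *)

Section euclidean.
Context {R : realType} {n : nat}.
Implicit Types (x y v : n.-tuple R).


Lemma measurable_fun_edist d (T : measurableType d) (f g : T -> n.-tuple R) :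
  measurable_fun setT f -> measurable_fun setT g ->
  measurable_fun setT (fun t => edist (f t) (g t)).
Proof.
move=> mf mg; rewrite /edist; apply: (@measurableT_comp _ _ _ _ _ _ (@Num.sqrt R)).
  by apply: continuous_measurable_fun => x; exact: sqrt_continuous.
apply: measurable_sum => i; apply: measurable_funX; apply: measurable_funB.
- exact: (measurableT_comp (measurable_tnth i)).
- exact: (measurableT_comp (measurable_tnth i)).
Qed.

Lemma edist_ge0 x y : 0 <= edist x y.
Proof. exact: sqrtr_ge0. Qed.

Lemma enormE x : enorm x = edist x [tuple 0 | i < n].
Proof.
by congr Num.sqrt; apply: eq_bigr => i _; rewrite tnth_mktuple subr0.
Qed.

Lemma edistxx x : edist x x = 0.
Proof. by rewrite /edist big1 ?sqrtr0// => i _; rewrite subrr expr0n. Qed.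

Lemma le_coord_edist x y i : `|tnth x i - tnth y i| <= edist x y.
Proof.
rewrite -sqrtr_sqr ler_wsqrtr// (bigD1 i)//= lerDl.
by apply: sumr_ge0 => j _; exact: sqr_ge0.
Qed.

Lemma edist_eq0 x y : (edist x y == 0) = (x == y).
Proof.
apply/idP/eqP => [/eqP xy|->]; last by rewrite edistxx.
apply: eq_from_tnth => i; apply/eqP.
by rewrite -subr_eq0 -normr_le0 -xy le_coord_edist.
Qed.

Let boxes : set (set (n.-tuple R)) := [set A | exists a b, A = box a b].

Let boxes_setI : setI_closed boxes.
Proof.
move=> _ _ [a [b ->]] [a' [b' ->]].
exists [tuple Num.max (tnth a i) (tnth a' i) | i < n].
exists [tuple Num.min (tnth b i) (tnth b' i) | i < n].
apply/seteqP; split => x /=.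
  move=> [h h'] i; rewrite !tnth_mktuple ge_max le_min.
  by case/andP: (h i) => -> ->; case/andP: (h' i) => -> ->.
move=> h; split=> i; move: (h i); rewrite !tnth_mktuple ge_max le_min;
by move=> /andP[/andP[h1 h2] /andP[h3 h4]]; apply/andP.
Qed.

Let cube (m : nat) : set (n.-tuple R) :=
  box [tuple - m%:R | i < n] [tuple m%:R | i < n].

Lemma exists_nat_ge_coord x : exists m : nat, forall i, `|tnth x i| <= m%:R.
Proof.
exists (Num.truncn (\sum_i `|tnth x i|)).+1 => i.
apply: (@le_trans _ _ (\sum_i `|tnth x i|)); last exact/ltW/truncnS_gt.
by rewrite (bigD1 i)//= lerDl sumr_ge0.
Qed.

Let cube_cover : \bigcup_m cube m = setT.
Proof.
apply/seteqP; split => // x _; have [m hm] := exists_nat_ge_coord x.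
by exists m => // i; rewrite !tnth_mktuple -ler_norml.
Qed.

Let boxes_generate : @measurable _ (n.-tuple R) = <<s boxes >>.
Proof.
rewrite eqEsubset; split; last first.
  apply: smallest_sub; first exact: sigma_algebra_measurable.
  move=> _ [a [b ->]].
  have -> : box a b = \bigcap_(i in [set: 'I_n])
      ((@tnth n R ^~ i) @^-1` [set` `[tnth a i, tnth b i]]).
    apply/seteqP; split => x /=.
      by move=> h i _; rewrite /= in_itv/=; exact: h.
    by move=> h i; have := h i Logic.I; rewrite /= in_itv.
  apply: fin_bigcap_measurable => // i _.
  by rewrite -[X in measurable X]setTI; apply: measurable_tnth.
suff H i : @measurable_fun _ _ (g_sigma_algebraType boxes) R setT (@tnth n R ^~ i).
  apply: smallest_sub; first exact: smallest_sigma_algebra.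
  rewrite -bigcup_seq => A [i _ [B mB <-]].
  by apply: H.
apply: (measurability (@RGenCInfty.G R)) => [|/= _ [_] [r] -> <-].
  exact: RGenCInfty.measurableE.
rewrite setTI.
(* A half-space is the union of growing boxes that share the lower bound [r] in coordinate [i]. *)
pose g m := box [tuple if j == i then r else - m%:R | j < n] [tuple m%:R | j < n].
have -> : (@tnth n R ^~ i) @^-1` `[r, +oo[%classic = \bigcup_m g m.
  apply/seteqP; split => x /=.
    rewrite in_itv/= andbT => rx; have [m hm] := exists_nat_ge_coord x.
    exists m => // j; rewrite !tnth_mktuple.
    have := hm j; rewrite ler_norml => /andP[h1 h2].
    by case: eqP => [->|_]; rewrite ?rx ?h1 ?h2//= (le_trans _ (hm i))// ler_norm.
  move=> [m _ /(_ i)]; rewrite !tnth_mktuple eqxx => /andP[h _].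
  by rewrite in_itv/= h.
apply: bigcupT_measurable => m; apply: sub_sigma_algebra.
by rewrite /boxes /=; do 2 eexists.
Qed.

Lemma box_measure_unique (m1 m2 : {measure set (n.-tuple R) -> \bar R}) :
  (forall a b, m1 (box a b) = m2 (box a b)) ->
  (forall a b, (m1 (box a b) < +oo)%E) ->
  forall A, measurable A -> m1 A = m2 A.
Proof.
move=> m12 m1oo; apply: (measure_unique boxes cube) => //.
- by move=> i; do 2 eexists.
- by move=> _ [a [b ->]].
- by move=> k; exact: m1oo.
Qed.

Lemma measurable_box (a b : n.-tuple R) : measurable (box a b).
Proof. by rewrite boxes_generate; apply: sub_sigma_algebra; do 2 eexists. Qed.

End euclidean.

(** * Volumes of balls and integration in polar coordinates *)

Section lebesgue_n.
Context {R : realType} {n : nat}.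
Variable lam : {measure set (n.-tuple R) -> \bar R}.
Hypothesis lamE : is_lebesgue_n lam.
Hypothesis n0 : (0 < n)%N.
Implicit Types (x y v : n.-tuple R) (r : R).

Let box_empty (a b : n.-tuple R) i : tnth b i < tnth a i -> box a b = set0.
Proof.
move=> ba; apply/seteqP; split => // x /(_ i) /andP[ax xb].
by have := le_lt_trans (le_trans ax xb) ba; rewrite ltxx.
Qed.

Lemma lebesgue_n_box_fin (a b : n.-tuple R) : (lam (box a b) < +oo)%E.
Proof.
have [ab|] := pselect (forall i, tnth a i <= tnth b i).
  by rewrite lamE// ltry.
move=> /existsNP[i /negP]; rewrite -ltNge => ba.
by rewrite (box_empty ba) measure0.
Qed.

Lemma measurable_closed_eball v r : measurable [set x | edist x v <= r].
Proof.
have := measurable_fun_edist (@measurable_id _ _ setT) (measurable_cst v).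
move=> /(_ measurableT `]-oo, r]%classic); rewrite setTI.
have -> : [set x | edist x v <= r] =
    (fun t => edist (id t) (cst v t)) @^-1` `]-oo, r]%classic.
  by apply/seteqP; split => x /=; rewrite in_itv.
by apply; exact: measurable_itv.
Qed.

Lemma lebesgue_n_eball_fin v r : (lam [set x | (edist x v <= r)%R] < +oo)%E.
Proof.
pose a := [tuple tnth v i - r | i < n]; pose b := [tuple tnth v i + r | i < n].
apply: le_lt_trans (lebesgue_n_box_fin a b).
apply: le_measure; rewrite ?inE; [exact: measurable_closed_eball|exact: measurable_box|].
move=> x /= xv i; rewrite !tnth_mktuple -ler_distlC.
by rewrite distrC (le_trans (le_coord_edist _ _ _)).
Qed.

Lemma omegaE : lam [set x | enorm x <= 1] = (omega lam)%:E.
Proof.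
rewrite /omega fineK// ge0_fin_numE//.
have -> : [set x : n.-tuple R | enorm x <= 1] = [set x | edist x [tuple 0 | i < n] <= 1].
  by apply/seteqP; split => x /=; rewrite enormE.
exact: lebesgue_n_eball_fin.
Qed.

Lemma omega_ge0 : 0 <= omega lam.
Proof. exact: fine_ge0. Qed.

(** The map [T] takes the ball to the unit ball, and pushing [lam] forward along it multiplies the
    measure of every box, hence of every Borel set, by [r ^+ n]. *)
Lemma lebesgue_n_eball_gt0 v r : 0 < r ->
  lam [set x | edist x v <= r] = (omega lam * r ^+ n)%:E.
Proof.
move=> r0.
pose T x := [tuple (tnth x i - tnth v i) / r | i < n].
have mT : measurable_fun setT T.
  apply/measurable_fun_tnthP => i.
  have -> : (@tnth n R)^~ i \o T = (fun x => (tnth x i - tnth v i) / r).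
    by apply/funext => x /=; rewrite tnth_mktuple.
  apply: measurable_funM => //; apply: measurable_funB => //.
  exact: measurable_tnth.
have rn0 : 0 <= r ^+ n by rewrite exprn_ge0// ltW.
have TE a b : mpush lam mT (box a b) = mscale (NngNum rn0) lam (box a b).
  rewrite /mpush /= /pushforward /mscale /=.
  have -> : T @^-1` box a b =
     box [tuple r * tnth a i + tnth v i | i < n] [tuple r * tnth b i + tnth v i | i < n].
    by apply/seteqP; split => x /= h i; move: (h i); rewrite !tnth_mktuple;
      rewrite ler_pdivrMr// ler_pdivlMr// lerBrDr lerBlDr ![r * _]mulrC.
  have [ab|] := pselect (forall i, tnth a i <= tnth b i); last first.
    move=> /existsNP[i /negP]; rewrite -ltNge => ba.
    rewrite (box_empty ba) measure0 mule0 (@box_empty _ _ i) ?measure0//.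
    by rewrite !tnth_mktuple ltrD2r ltr_pM2l.
  rewrite !lamE//; last by move=> i; rewrite !tnth_mktuple lerD2r ler_pM2l.
  rewrite -EFinM; congr (_%:E).
  rewrite -[n in r ^+ n]card_ord -prodr_const -big_split/=.
  by apply: eq_bigr => i _; rewrite !tnth_mktuple; ring.
have TU A : measurable A -> mpush lam mT A = mscale (NngNum rn0) lam A.
  apply: box_measure_unique => // a b; rewrite TE /mscale/=.
  by rewrite lte_mul_pinfty// lebesgue_n_box_fin.
have mB : measurable [set x : n.-tuple R | enorm x <= 1].
  have -> : [set x : n.-tuple R | enorm x <= 1] = [set x | edist x [tuple 0 | i < n] <= 1].
    by apply/seteqP; split => x /=; rewrite enormE.
  exact: measurable_closed_eball.
have := TU _ mB; rewrite /mscale /= omegaE -EFinM mulrC => <-.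
rewrite /mpush /= /pushforward; congr (lam _).
have TN x : enorm (T x) = edist x v / r.
  rewrite /enorm /edist -[r in RHS]gtr0_norm// -sqrtr_sqr -sqrtrV ?sqr_ge0//.
  rewrite -sqrtrM ?sumr_ge0//; last by move=> i _; exact: sqr_ge0.
  congr Num.sqrt; rewrite mulr_suml; apply: eq_bigr => i _.
  by rewrite tnth_mktuple exprMn exprVn.
by apply/seteqP; split => x /=; rewrite TN ler_pdivrMr// mul1r.
Qed.

Lemma lebesgue_n_eball v r :
  lam [set x | edist x v <= r] = (omega lam * (Num.max r 0) ^+ n)%:E.
Proof.
have [r0|r0|->] := ltgtP r 0.
- have -> : [set x | edist x v <= r] = set0.
    apply/seteqP; split => // x /= h.
    by have := le_lt_trans (le_trans (edist_ge0 x v) h) r0; rewrite ltxx.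
  by rewrite measure0 expr0n gtn_eqF// mulr0.
- exact: lebesgue_n_eball_gt0.
- have -> : [set x | edist x v <= 0] = box v v.
    apply/seteqP; split => x /=.
      rewrite le_eqVlt ltNge edist_ge0 orbF edist_eq0 => /eqP -> i.
      by rewrite lexx.
    move=> h; have -> : x = v by apply: eq_from_tnth => i; apply/eqP; rewrite eq_sym eq_le h.
    by rewrite edistxx.
  rewrite lamE// expr0n gtn_eqF// mulr0; congr (_%:E).
  case: n n0 v => // m _ v; rewrite big_ord_recl subrr mul0r//.
Qed.

(** The area of the sphere of radius [r], cut off at negative radii so as to be a density on the
    whole line. *)
Definition radial_density (r : R) : R :=
  (n%:R * omega lam * r ^+ n.-1) *+ (0 <= r)%R.

Lemma radial_density_ge0 r : 0 <= radial_density r.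
Proof.
rewrite /radial_density; case: (leP 0 r) => //= r0.
by rewrite mulr_ge0 ?exprn_ge0// mulr_ge0 ?omega_ge0.
Qed.

Lemma measurable_radial_density : measurable_fun setT radial_density.
Proof.
have -> : radial_density = (fun r => (n%:R * omega lam * r ^+ n.-1)%R) \_ `[0, +oo[%classic.
  apply/funext => r; rewrite patchE /radial_density mem_setE in_itv/= andbT.
  by case: (0 <= r).
apply/(measurable_restrictT _ _).1 => //; apply: measurable_funTS.
by apply: measurable_funM => //; apply: measurable_funX.
Qed.


Let power_deriv (a b : R) : 0 <= a -> a < b ->
  (\int[lebesgue_measure]_(x in `[a, b]) (n%:R * omega lam * x ^+ n.-1)%:E =
   (omega lam * b ^+ n - omega lam * a ^+ n)%:E)%E.
Proof.
move=> a0 ab.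
have D (x : R) : is_derive x 1 (fun y : R => omega lam * y ^+ n) (n%:R * omega lam * x ^+ n.-1).
  have -> : (fun y : R => omega lam * y ^+ n) = omega lam \*: (id ^+ n : R -> R).
    by apply/funext => y; rewrite /= exprfctE.
  apply: is_derive_eq.
  by rewrite /GRing.scale/= mulr1 mulrCA mulrA.
have dF (x : R) : derivable (fun y : R => omega lam * y ^+ n) x 1 by have [] := D x.
have cF (x : R) : {for x, continuous (fun y : R => omega lam * y ^+ n)}.
  by apply: differentiable_continuous; apply/derivable1_diffP.
rewrite (@continuous_FTC2 _ _ (fun y : R => omega lam * y ^+ n))//.
- apply: continuous_subspaceT => x; apply: cvgM; first exact: cvg_cst.
  exact: exprn_continuous.
- split; first by move=> x _; exact: dF.
  + by apply: cvg_at_right_filter; exact: cF.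
  + by apply: cvg_at_left_filter; exact: cF.
- by move=> x _; rewrite derive1E; have [_ ->] := D x.
Qed.

Let measurable_edist_R v :
  measurable_fun setT ((fun x => edist x v) : n.-tuple R -> measurableTypeR R).
Proof.
by move=> _ Y mY; apply: (@measurable_fun_edist _ _ _ _ id (cst v)).
Qed.

Let radial v := mpush lam (measurable_edist_R v).

(** On a half-open interval one side follows from the fundamental theorem of calculus and the other
    is a difference of ball volumes; such intervals determine the measure. *)
Lemma radial_measure v A :
  measurable A ->
  mdensity lebesgue_measure measurable_radial_density radial_density_ge0 A =
  radial v A.
Proof.
have E (X : set R) : ocitv X ->
  mdensity lebesgue_measure measurable_radial_density radial_density_ge0 X =
  radial v X.
  move=> [[a b] /= _ <-].
  have [ba|ab] := leP b a.
    by rewrite set_itv_ge ?measure0// bnd_simp -leNgt.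
  rewrite /mdensity /radial /mpush /= /pushforward.
  have -> : (fun x => edist x v) @^-1` `]a, b]%classic =
      [set x | edist x v <= b] `\` [set x | edist x v <= a].
    apply/seteqP; split => x /=; rewrite in_itv/=.
      by move=> /andP[h1 h2]; split => //; apply/negP; rewrite -ltNge.
    by move=> [-> /negP]; rewrite -ltNge => ->.
  rewrite measureD; [|exact: measurable_closed_eball|exact: measurable_closed_eball|exact: lebesgue_n_eball_fin].
  rewrite setIidr; last by move=> x /= h; exact: le_trans h (ltW ab).
  rewrite [X in _ = (X - _)%E](lebesgue_n_eball v b).
  rewrite [X in _ = (_ - X)%E](lebesgue_n_eball v a) -EFinB.
  have mc : measurable_fun setT (fun r : R => (n%:R * omega lam * r ^+ n.-1)%:E).
    apply/measurable_EFinP.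
    by apply: measurable_funM => //; apply: measurable_funX.
  have -> : (\int[lebesgue_measure]_(x in `]a, b]) (radial_density x)%:E =
     \int[lebesgue_measure]_(x in `]a, b] `&` `[0%R, +oo[) (n%:R * omega lam * x ^+ n.-1)%:E)%E.
    rewrite integral_mkcondr; apply: eq_integral => x _.
    rewrite patchE /radial_density mem_setE in_itv/= andbT.
    by case: (0 <= x).
  have [b0|b0] := ltP b 0.
    have -> : `]a, b] `&` `[0%R, +oo[ = set0 :> set R.
      apply/seteqP; split => // x []; rewrite /= !in_itv/= andbT => /andP[_ h] h'.
      by have := le_lt_trans (le_trans h' h) b0; rewrite ltxx.
    by rewrite integral_set0 (max_r (ltW (lt_trans ab b0))) subrr.
  have [a0|a0] := ltP a 0.
    have -> : `]a, b] `&` `[0%R, +oo[ = `[0%R, b]%classic :> set R.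
      apply/seteqP; split => x /=; rewrite !in_itv/= andbT.
        by move=> [/andP[_ ->] ->].
      by move=> /andP[h ->]; rewrite (lt_le_trans a0 h).
    rewrite expr0n gtn_eqF// mulr0 subr0.
    move: b0; rewrite le_eqVlt => /predU1P[<-|b0].
      by rewrite set_itv1 integral_set1 expr0n gtn_eqF// mulr0.
    by rewrite power_deriv// expr0n gtn_eqF// mulr0 subr0.
  have -> : `]a, b] `&` `[0%R, +oo[ = `]a, b]%classic :> set R.
    apply/seteqP; split => x /=; rewrite !in_itv/= andbT; first by case.
    by move=> /andP[h1 h2]; rewrite h1 h2 (le_trans a0 (ltW h1)).
  rewrite integral_itv_obnd_cbnd; last exact: measurable_funTS.
  by rewrite power_deriv.
move=> mA.
pose m1 : {measure set (measurableTypeR R) -> \bar R} :=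
  mdensity lebesgue_measure measurable_radial_density radial_density_ge0.
pose m2 : {measure set (measurableTypeR R) -> \bar R} := radial v.
apply: (@measure_unique _ R (measurableTypeR R) (@ocitv R)
  (fun k => `]- k%:R, k%:R]%classic) _ _ _ _ m1 m2) => //.
- exact: ocitvI.
- by move=> k; exists (- k%:R, k%:R).
- apply/seteqP; split => // x _; exists (Num.truncn `|x|).+1 => //=.
  rewrite in_itv/=; have /ltr_normlP[h1 h2] := truncnS_gt `|x|.
  by rewrite ltrNl h1 ltW.
- move=> k; rewrite [X in (X < _)%E](E `]- k%:R, k%:R]%classic); last by exists (- k%:R, k%:R).
  apply: le_lt_trans (lebesgue_n_eball_fin v k%:R).
  rewrite -[X in (X <= _)%E]/(lam ((fun x => edist x v) @^-1` `]- k%:R, k%:R]%classic)).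
  apply: le_measure; rewrite ?inE.
  + by rewrite -[X in measurable X]setTI; apply: measurable_edist_R => //; exact: measurable_itv.
  + exact: measurable_closed_eball.
  + by move=> x /=; rewrite in_itv/= => /andP[].
Qed.

Lemma integral_radial v (h : R -> \bar R) :
  measurable_fun setT h -> (forall r, (0 <= h r)%E) ->
  (\int[lam]_x h (edist x v) =
   \int[lebesgue_measure]_(r in `[0%R, +oo[) (h r * (n%:R * omega lam * r ^+ n.-1)%:E))%E.
Proof.
move=> mh h0.
rewrite -(ge0_integral_mpush lam (measurable_edist_R v))//.
rewrite (eq_measure_integral (mdensity lebesgue_measure measurable_radial_density radial_density_ge0)); last first.
  by move=> A mA _; apply/esym; exact: radial_measure.
rewrite (@ge0_integral_density _ (measurableTypeR R) R lebesgue_measure _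
  radial_density _ measurable_radial_density radial_density_ge0)//.
rewrite [RHS]integral_mkcond; apply: eq_integral => x _.
rewrite patchE mem_setE in_itv/= andbT /radial_density.
by case: (0 <= x); rewrite ?mulr1n// mulr0n mule0.
Qed.

End lebesgue_n.
(** * Legendre transform and inverse derivative of [f] *)

Section derivative_epsilon.
Context {R : realType}.
Implicit Types (f : R -> R) (x l : R).

Lemma derivable_epsilon f x : derivable f x 1 -> forall e, 0 < e ->
  exists2 d, 0 < d &
    forall h, `|h| < d -> `|f (x + h) - f x - derive1 f x * h| <= e * `|h|.
Proof.
move=> /cvg_ex[l hl] e e0.
have lE : derive1 f x = l by rewrite derive1E; apply/cvg_lim.
move/cvgrPdist_le : hl => /(_ e e0) /nbhs_ballP[d /= d0 hd].
exists d => // h hd'; have [->|h0] := eqVneq h 0.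
  by rewrite addr0 subrr mulr0 subrr normr0 mulr0.
have /hd/(_ h0) : ball (0 : R) d h by rewrite /ball/= sub0r normrN.
rewrite /= /shift /GRing.scale/= mulr1 (addrC h x) lE.
have -> : f (x + h) - f x - l * h = - (l - h^-1 * (f (x + h) - f x)) * h.
  by field.
by rewrite normrM normrN; apply: ler_wpM2r.
Qed.

Lemma is_derive_epsilon f x l : (forall e, 0 < e -> exists2 d, 0 < d &
    forall h, `|h| < d -> `|f (x + h) - f x - l * h| <= e * `|h|) ->
  is_derive x (1 : R) f l.
Proof.
move=> H.
have hl : (h^-1 *: ((f \o shift x) (h *: 1) - f x)) @[h --> (0 : R)^'] --> l.
  apply/cvgrPdist_le => e e0; have [d d0 hd] := H e e0.
  apply/nbhs_ballP; exists d => //= h; rewrite /ball/= sub0r normrN => hd' h0.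
  rewrite /= /shift /GRing.scale/= mulr1 (addrC h x).
  have := hd h hd'.
  have -> : f (x + h) - f x - l * h = - (l - h^-1 * (f (x + h) - f x)) * h.
    by field.
  by rewrite normrM normrN ler_pM2r// normr_gt0.
split; first by apply/cvg_ex; exists l.
exact/cvg_lim.
Qed.

End derivative_epsilon.

Section legendre_transform.
Context {R : realType}.
Variables f k : R -> R.
Hypothesis hf : standing_f f.
Hypothesis hk : is_inv_deriv f k.

Let f_ge0 t : 0 <= t -> 0 <= f t. Proof. by case: hf => h _; exact: h. Qed.
Let f_convex x y t : 0 <= x -> 0 <= y -> x != y -> 0 < t < 1 ->
  f (t * x + (1 - t) * y) < t * f x + (1 - t) * f y.
Proof. by case: hf => _ [h _]; exact: h. Qed.
Let f_deriv x : 0 < x -> derivable f x 1.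
Proof. by case: hf => _ [_ [h _]]; exact: h. Qed.
Let f0 : f 0 = 0. Proof. by case: hf => _ [_ [_ [_ []]]]. Qed.
Let k0 : k 0 = 0. Proof. by case: hk. Qed.
Let k_gt0 t : 0 < t -> 0 < k t. Proof. by case: hk => _ h /h[]. Qed.
Let f'k t : 0 < t -> derive1 f (k t) = t. Proof. by case: hk => _ h /h[]. Qed.
Let k_ge0 t : 0 <= t -> 0 <= k t.
Proof. by rewrite le_eqVlt => /predU1P[<-|/k_gt0/ltW//]; rewrite k0. Qed.

Lemma convex_tangent x u : 0 < x -> 0 <= u ->
  f x + derive1 f x * (u - x) <= f u.
Proof.
move=> x0 u0; have [->|ux] := eqVneq u x; first by rewrite subrr mulr0 addr0.
apply/ler_addgt0Pr => e e0.
have q0 : 0 < `|u - x| by rewrite normr_gt0 subr_eq0.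
(* The tolerance is divided by [|u - x|] so that the increment [t * (u - x)] causes an error
   [e * t], which survives the final division by [t]. *)
have [d d0 hd] := derivable_epsilon (f_deriv x0) (divr_gt0 e0 q0).
pose t := Num.min (1 / 2) (d / 2 / `|u - x|).
have t0 : 0 < t by rewrite lt_min !divr_gt0.
have t1 : t < 1 by rewrite gt_min; apply/orP; left; lra.
have td : t * `|u - x| <= d / 2 by rewrite -ler_pdivlMr// ge_min lexx orbT.
have th : `|t * (u - x)| < d by rewrite normrM gtr0_norm//; lra.
have := hd _ th; rewrite normrM (gtr0_norm t0).
have -> : e / `|u - x| * (t * `|u - x|) = e * t by field; rewrite gt_eqF.
rewrite ler_norml => /andP[h1 _].
have h2 : f (t * u + (1 - t) * x) < t * f u + (1 - t) * f x.
  by apply: f_convex => //; [exact: ltW|rewrite t0 t1].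
have xe : t * u + (1 - t) * x = x + t * (u - x) by ring.
rewrite xe in h2.
rewrite -(ler_pM2l t0).
nra.
Qed.

(** The tangent inequality at the midpoint [z], combined with strict convexity there. *)
Lemma strict_convex_tangent x u : 0 < x -> 0 <= u -> u != x ->
  f x + derive1 f x * (u - x) < f u.
Proof.
move=> x0 u0 ux.
have h1 : f (1 / 2 * u + (1 - 1 / 2) * x) < 1 / 2 * f u + (1 - 1 / 2) * f x.
  by apply: f_convex => //; [exact: ltW|lra].
have := @convex_tangent x (1 / 2 * u + (1 - 1 / 2) * x) x0.
set z := _ + _ in h1 *.
have -> : z - x = (u - x) / 2 by rewrite /z; field.
have z0 : 0 <= z by rewrite /z; lra.
move=> /(_ z0); lra.
Qed.

Lemma derive1_strict_convex_gt0 x : 0 < x -> 0 < derive1 f x.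
Proof.
move=> x0; have := @strict_convex_tangent x 0 x0 (lexx _).
rewrite eq_sym gt_eqF// f0 => /(_ isT).
have := f_ge0 (ltW x0); nra.
Qed.

(** [is_inv_deriv] makes [k] a right inverse of [derive1 f]; this is the left inverse. Two distinct
    points with the same slope would satisfy tangent inequalities, one of them strict, that add up
    to a contradiction. *)
Lemma inv_deriv_surj x : 0 < x -> k (derive1 f x) = x.
Proof.
move=> x0; have s0 := derive1_strict_convex_gt0 x0.
apply/eqP; apply: contraT => ks.
have h1 := strict_convex_tangent x0 (ltW (k_gt0 s0)) ks.
have := convex_tangent (k_gt0 s0) (ltW x0).
rewrite f'k//; nra.
Qed.

(** The convex conjugate of [f] at [s]: the supremum of [s * u - f u] is attained at [u = k s]. *)
Definition legendre s := s * k s - f (k s).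

(** The tangent inequality at [k s], where the slope is [s]; for [s = 0] it reduces to
    [0 <= f u]. *)
Lemma young s u : 0 <= s -> 0 <= u -> s * u <= f u + legendre s.
Proof.
rewrite le_eqVlt => /predU1P[<- u0|s0 u0].
  by rewrite /legendre k0 f0 !mul0r !subr0 addr0 f_ge0.
have := convex_tangent (k_gt0 s0) u0.
by rewrite f'k// /legendre; nra.
Qed.

(** Adding Young's inequality for [s] and [k t] to that for [t] and [k s] gives
    [0 <= (t - s) * (k t - k s)]. *)
Lemma inv_deriv_le s t : 0 <= s -> s <= t -> k s <= k t.
Proof.
move=> s0; rewrite le_eqVlt => /predU1P[->//|st].
have t0 := lt_le_trans (le_lt_trans s0 st) (lexx _).
have h1 := young s0 (k_ge0 (ltW t0)).
have h2 := young (ltW t0) (k_ge0 s0).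
rewrite /legendre in h1 h2; nra.
Qed.

(** [k] and the conjugate are unspecified at negative arguments; composing with the positive part
    makes them vanish there. *)
Definition kp t := k (Num.max t 0).

Definition legendrep t := legendre (Num.max t 0).

Let max0_ge0 (t : R) : 0 <= Num.max t 0. Proof. by rewrite le_max lexx orbT. Qed.

Lemma kp_ge0 t : 0 <= kp t. Proof. exact: k_ge0. Qed.

Lemma kp_le0 t : t <= 0 -> kp t = 0.
Proof. by move=> t0; rewrite /kp max_r. Qed.

Lemma kpE t : 0 <= t -> kp t = k t.
Proof. by move=> t0; rewrite /kp max_l. Qed.

Lemma kp_homo : {homo kp : s t / s <= t}.
Proof.
by move=> s t st; apply: inv_deriv_le => //; rewrite ge_max !le_max st lexx !orbT.
Qed.

Lemma kp_unbounded M : exists2 c, 0 <= c & M <= kp c.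
Proof.
pose x := Num.max M 1; have x0 : 0 < x by rewrite lt_max ltr01 orbT.
exists (derive1 f x); first exact/ltW/derive1_strict_convex_gt0.
by rewrite kpE ?inv_deriv_surj ?le_max ?lexx//; exact/ltW/derive1_strict_convex_gt0.
Qed.

(** A monotone function without gaps in its range has no jumps: [derive1 f] at [kp s + e] and, if
    positive, at [kp s - e] gives points on either side of [s] where these two values are taken. *)
Lemma kp_continuous : continuous kp.
Proof.
move=> s; apply/cvgrPdist_le => e e0.
have x0 : 0 < kp s + e by rewrite ltr_wpDl// kp_ge0.
have t0 := derive1_strict_convex_gt0 x0.
have st : s < derive1 f (kp s + e).
  rewrite ltNge; apply/negP => /kp_homo.
  by rewrite [X in X <= _]kpE ?(ltW t0)// inv_deriv_surj//; lra.
have U : \forall t \near s, kp t <= kp s + e.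
  apply: filterS (lt_nbhsl st) => t /ltW/kp_homo.
  by rewrite [X in _ <= X]kpE ?(ltW t0)// inv_deriv_surj.
suff L : \forall t \near s, kp s - e <= kp t.
  near=> t; have h1 : kp t <= kp s + e by near: t.
  have h2 : kp s - e <= kp t by near: t.
  rewrite ler_norml; apply/andP; split; lra.
have [y0|y0] := leP (kp s - e) 0.
  by near=> t; exact: le_trans (kp_ge0 t).
have u0 := derive1_strict_convex_gt0 y0.
have us : derive1 f (kp s - e) < s.
  rewrite ltNge; apply/negP => /kp_homo.
  by rewrite [X in _ <= X]kpE ?(ltW u0)// inv_deriv_surj//; lra.
apply: filterS (lt_nbhsr us) => t /ltW/kp_homo.
by rewrite [X in X <= _]kpE ?(ltW u0)// inv_deriv_surj.
Unshelve. all: by end_near. Qed.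

Lemma legendrep_ge0 t : 0 <= legendrep t.
Proof. by have := young (max0_ge0 t) (lexx 0); rewrite mulr0 f0 add0r. Qed.

Lemma legendrep_le0 t : t <= 0 -> legendrep t = 0.
Proof. by move=> t0; rewrite /legendrep max_r// /legendre k0 f0 mul0r subr0. Qed.

(** Expresses that [k] is the derivative of the conjugate, in a form that can be integrated over the
    space as it stands. *)
Lemma legendrep_sandwich s t : s <= t ->
  kp s * (t - s) <= legendrep t - legendrep s <= kp t * (t - s).
Proof.
move=> st; rewrite /legendrep /kp.
have [t0|t0] := ltP t 0.
  by rewrite [Num.max s 0]max_r ?k0 ?mul0r ?subrr ?lexx// ltW// (le_lt_trans st).
have [s0|s0] := ltP s 0.
  rewrite k0 mul0r.
  have -> : legendre 0 = 0 by rewrite /legendre k0 f0 mul0r subr0.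
  have h1 := young t0 (lexx 0); have h2 := f_ge0 (k_ge0 t0).
  rewrite mulr0 f0 in h1; have h3 := k_ge0 t0.
  by rewrite /legendre in h1 *; apply/andP; split; nra.
have h1 := young s0 (k_ge0 t0); have h2 := young t0 (k_ge0 s0).
by rewrite /legendre in h1 h2 *; apply/andP; split; nra.
Qed.

Lemma legendrep_homo : {homo legendrep : s t / s <= t}.
Proof.
move=> s t st; have /andP[h _] := legendrep_sandwich st.
by have := kp_ge0 s; nra.
Qed.

Lemma standing_homo s t : 0 <= s -> s <= t -> f s <= f t.
Proof.
rewrite le_eqVlt => /predU1P[<- t0|s0 st]; first by rewrite f0 f_ge0.
have := convex_tangent s0 (le_trans (ltW s0) st).
by have := derive1_strict_convex_gt0 s0; nra.
Qed.

End legendre_transform.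
(** * The optimal cost [phi] *)

Section radial_energy.
Context {R : realType} {n : nat}.
Variable lam : {measure set (n.-tuple R) -> \bar R}.
Hypothesis lamE : is_lebesgue_n lam.
Hypothesis n0 : (0 < n)%N.
Variable p : R.
Hypothesis p1 : 1 <= p.

(** The features shared by [kp k] and [legendrep f k]; composed with a tent, such a function is
    bounded and vanishes outside a ball. *)
Record profile (H : R -> R) : Prop := Profile {
  profile_ge0 : forall t, 0 <= H t ;
  profile_le0 : forall t, t <= 0 -> H t = 0 ;
  profile_homo : {homo H : s t / s <= t} }.

(** The positive part is left to the profile, so that tents with the same centre differ by a
    constant. *)
Definition tent (v : n.-tuple R) (c : R) (x : n.-tuple R) : R :=
  c - edist x v `^ p.

Lemma measurable_tent v c : measurable_fun setT (tent v c).
Proof.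
apply: measurable_funB => //.
apply: (measurableT_comp (measurable_powR p)).
exact: (@measurable_fun_edist _ _ _ _ id (cst v)).
Qed.

Lemma measurable_profileR H v c : profile H ->
  measurable_fun setT (fun x => H (tent v c x)).
Proof.
move=> hH; apply: measurableT_comp (measurable_tent v c).
by apply: nondecreasing_measurable => // s t; exact: profile_homo.
Qed.

Lemma measurable_profile H v c : profile H ->
  measurable_fun setT (fun x => (H (tent v c x))%:E).
Proof. by move=> hH; apply/measurable_EFinP; apply: measurable_profileR. Qed.

(** Beyond distance [1] the exponent [p >= 1] can only enlarge the distance, so the crude radius
    [|c| + 1] works for every [p]. *)
Lemma tent_le0 v c x : `|c| + 1 < edist x v -> tent v c x <= 0.
Proof.
move=> cx; rewrite /tent subr_le0.
have d1 : 1 <= edist x v by rewrite (le_trans _ (ltW cx))// lerDr.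
apply: (@le_trans _ _ (edist x v `^ 1)); last exact: ler_powR.
rewrite powRr1//; last exact: edist_ge0.
apply: (le_trans (ler_norm c)); apply: le_trans (ltW cx).
by rewrite lerDl.
Qed.

Lemma tent_le v c x : tent v c x <= c.
Proof. by rewrite /tent gerBl powR_ge0. Qed.

Lemma profile_integral_fin H v c : profile H ->
  (\int[lam]_x (H (tent v c x))%:E < +oo)%E.
Proof.
move=> hH.
have mB := @measurable_closed_eball _ _ v (`|c| + 1).
apply: (@le_lt_trans _ _
  (\int[lam]_(x in [set x | (edist x v <= `|c| + 1)%R]) (H c)%:E)%E).
  rewrite [leRHS]integral_mkcond; apply: ge0_le_integral => //.
  - by move=> x _; rewrite lee_fin profile_ge0.
  - exact: measurable_profile.
  - by apply/(measurable_restrictT _ _).1.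
  - move=> x _; rewrite patchE; case: ifPn.
      by rewrite lee_fin => _; apply: profile_homo => //; exact: tent_le.
    rewrite notin_setE => /negP; rewrite -ltNge => /tent_le0 h.
    by rewrite profile_le0.
rewrite integral_cst// lte_mul_pinfty ?lee_fin ?profile_ge0//.
exact: lebesgue_n_eball_fin.
Qed.

(* By [massE] the centre of the tent is irrelevant. *)
Definition mass (H : R -> R) (c : R) : R :=
  fine (\int[lam]_x (H (tent [tuple 0 | i < n] c x))%:E)%E.

Let hr H c (hH : profile H) :
  measurable_fun setT (fun r : R => (H (c - r `^ p))%:E).
Proof.
apply/measurable_EFinP; apply: measurableT_comp.
  by apply: nondecreasing_measurable => // s t; exact: profile_homo.
by apply: measurable_funB => //; exact: measurable_powR.
Qed.

Lemma mass_radial H c : profile H ->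
  ((mass H c)%:E = \int[lebesgue_measure]_(r in `[0%R, +oo[)
     (H (c - r `^ p) * (n%:R * omega lam * r ^+ n.-1))%:E)%E.
Proof.
move=> hH; rewrite /mass fineK; last first.
  rewrite ge0_fin_numE; first exact: profile_integral_fin.
  by apply: integral_ge0 => x _; rewrite lee_fin profile_ge0.
rewrite /tent (integral_radial lamE n0 [tuple 0 | i < n] (hr c hH))//.
by move=> r; rewrite lee_fin profile_ge0.
Qed.

Lemma massE H v c : profile H ->
  (\int[lam]_x (H (tent v c x))%:E = (mass H c)%:E)%E.
Proof.
move=> hH; rewrite mass_radial// /tent.
rewrite (integral_radial lamE n0 v (hr c hH))//.
by move=> r; rewrite lee_fin profile_ge0.
Qed.

Lemma mass_ge0 H c : profile H -> 0 <= mass H c.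
Proof.
move=> hH; apply: fine_ge0; apply: integral_ge0 => x _.
by rewrite lee_fin profile_ge0.
Qed.

Lemma mass_le0 H c : profile H -> c <= 0 -> mass H c = 0.
Proof.
move=> hH c0; rewrite /mass integral0_eq// => x _.
by rewrite profile_le0// (le_trans (tent_le _ _ _)).
Qed.

Lemma mass_homo H : profile H -> {homo mass H : s t / s <= t}.
Proof.
move=> hH s t st; rewrite -lee_fin -!(massE [tuple 0 | i < n])//.
apply: ge0_le_integral => //.
- by move=> x _; rewrite lee_fin profile_ge0.
- exact: measurable_profile.
- exact: measurable_profile.
- by move=> x _; rewrite lee_fin; apply: profile_homo => //; exact: lerB.
Qed.

Lemma mass_add H1 H2 v c1 c2 a : profile H1 -> profile H2 -> 0 <= a ->
  (\int[lam]_x (a * H1 (tent v c1 x) + H2 (tent v c2 x))%:E =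
   (a * mass H1 c1 + mass H2 c2)%:E)%E.
Proof.
move=> h1 h2 a0.
under eq_integral do rewrite EFinD EFinM.
rewrite ge0_integralD//.
- rewrite ge0_integralZl//.
  + by rewrite !massE.
  + exact: measurable_profile.
  + by move=> x _; rewrite lee_fin profile_ge0.
- by move=> x _; rewrite -EFinM lee_fin; apply: mulr_ge0 => //; exact: profile_ge0.
- by apply: emeasurable_funM => //; exact: measurable_profile.
- by move=> x _; rewrite lee_fin profile_ge0.
- exact: measurable_profile.
Qed.

Lemma measurable_mass_add H1 H2 v c1 c2 a : profile H1 -> profile H2 ->
  measurable_fun setT (fun x => (a * H1 (tent v c1 x) + H2 (tent v c2 x))%:E).
Proof.
move=> h1 h2; apply/measurable_EFinP.
have m1 := measurable_profileR v c1 h1; have m2 := measurable_profileR v c2 h2.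
exact: (measurable_funD (measurable_funM (measurable_cst a) m1) m2).
Qed.

(** Continuity under the integral on []c - 1, c + 1[]; by monotonicity the profile at level [c + 1]
    dominates. *)
Lemma mass_continuous H : profile H -> continuous H -> continuous (mass H).
Proof.
move=> hH cH c.
pose v : n.-tuple R := [tuple 0 | i < n].
have int c' : lam.-integrable setT (EFin \o (fun x => H (tent v c' x))).
  apply/integrableP; split; first exact: measurable_profile.
  apply: le_lt_trans (@profile_integral_fin H v c' hH).
  rewrite le_eqVlt; apply/orP; left; apply/eqP; apply: eq_integral => x _ /=.
  by rewrite ger0_norm ?profile_ge0.
have := @continuity_under_integral _ _ _ lam (fun c x => H (tent v c x)) setT
  measurableT (c - 1) (c + 1) (fun c' _ => int c') _
  (fun x => H (tent v (c + 1) x)) (int _) _ c.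
apply.
- apply: aeW => x _ c' _.
  apply: (@continuous_comp _ _ _ (fun c : R => tent v c x)); last exact: cH.
  by apply: cvgB; [exact: cvg_id|exact: cvg_cst].
- move=> c'; rewrite /= in_itv/= => /andP[_ h]; apply: aeW => x _.
  rewrite ger0_norm ?profile_ge0//; apply: profile_homo => //.
  by apply: lerB => //; exact: ltW.
- by rewrite inE/= in_itv/=; apply/andP; split; lra.
Qed.

End radial_energy.

(** * Mass and cost as functions of the level *)

Section optimal_cost.
Context {R : realType} {n : nat}.
Variable lam : {measure set (n.-tuple R) -> \bar R}.
Hypothesis lamE : is_lebesgue_n lam.
Hypothesis n0 : (0 < n)%N.
Variable p : R.
Hypothesis p1 : 1 <= p.
Variables f k : R -> R.
Hypothesis hf : standing_f f.
Hypothesis hk : is_inv_deriv f k.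

Lemma profile_kp : profile (kp k).
Proof.
split; [exact: (kp_ge0 hk)|exact: (kp_le0 hk)|exact: (kp_homo hf hk)].
Qed.

Lemma profile_legendrep : profile (legendrep f k).
Proof.
split; [exact: (legendrep_ge0 hf hk)|exact: (legendrep_le0 hf hk)|].
exact: (legendrep_homo hf hk).
Qed.

Let hA := profile_kp.
Let hB := profile_legendrep.

(** [kmass] and [cmass] are the functions A and B of the overview. *)
Definition kmass := mass lam p (kp k).
Definition cmass := mass lam p (legendrep f k).
Definition pcost c := c * kmass c - cmass c.

Lemma kmass_homo : {homo kmass : s t / s <= t}.
Proof. exact: mass_homo. Qed.

Lemma kmass_le0 c : c <= 0 -> kmass c = 0.
Proof. exact: mass_le0. Qed.

Lemma kmass_continuous : continuous kmass.
Proof. by apply: mass_continuous => //; exact: (kp_continuous hf hk). Qed.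

(** B' = A in integrated form: [legendrep_sandwich] is integrated, the two tents differing by the
    constant [c' - c]. The inequalities are first put in additive form, so that only nonnegative
    functions are integrated. *)
Lemma cmass_sandwich c c' : c <= c' ->
  kmass c * (c' - c) <= cmass c' - cmass c <= kmass c' * (c' - c).
Proof.
move=> cc'; have d0 : 0 <= c' - c by rewrite subr_ge0.
pose v : n.-tuple R := [tuple 0 | i < n].
have tE x : tent p v c' x - tent p v c x = c' - c.
  by rewrite /tent; ring.
have tle x : tent p v c x <= tent p v c' x by rewrite -subr_ge0 tE.
have L : (c' - c) * kmass c + cmass c <= cmass c'.
  rewrite -lee_fin -(mass_add lamE n0 p1 v c c hA hB d0).
  rewrite -(massE lamE n0 p1 v c' hB).
  apply: ge0_le_integral => //.
  - move=> x _; rewrite lee_fin; apply: addr_ge0; last exact: (profile_ge0 hB).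
    by apply: mulr_ge0 => //; exact: (profile_ge0 hA).
  - exact: measurable_mass_add.
  - exact: measurable_profile.
  - move=> x _; rewrite lee_fin.
    have /andP[h _] := legendrep_sandwich hf hk (tle x).
    by rewrite tE in h; rewrite mulrC; lra.
have U : cmass c' <= (c' - c) * kmass c' + cmass c.
  rewrite -lee_fin -(mass_add lamE n0 p1 v c' c hA hB d0).
  rewrite -(massE lamE n0 p1 v c' hB).
  apply: ge0_le_integral => //.
  - by move=> x _; rewrite lee_fin; exact: (profile_ge0 hB).
  - exact: measurable_profile.
  - exact: measurable_mass_add.
  - move=> x _; rewrite lee_fin.
    have /andP[_ h] := legendrep_sandwich hf hk (tle x).
    by rewrite tE in h; rewrite mulrC; lra.
by apply/andP; split; lra.
Qed.

(** Reads d(cA - B) = c dA: the level is the marginal cost of mass. *)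
Lemma pcost_sandwich c c' : c <= c' ->
  c * (kmass c' - kmass c) <= pcost c' - pcost c <= c' * (kmass c' - kmass c).
Proof.
by move=> /cmass_sandwich/andP[h1 h2]; rewrite /pcost; apply/andP; split; nra.
Qed.

Hypothesis om0 : 0 < omega lam.

Lemma kmass_unbounded M : exists2 c, 0 <= c & M <= kmass c.
Proof.
have [c c0 hc] := kp_unbounded hf hk (M / omega lam).
(* On the unit ball around its centre, the tent of level [c + 1] stays above [c]. *)
exists (c + 1); first by rewrite addr_ge0.
apply: (@le_trans _ _ (kp k c * omega lam)); first by rewrite -ler_pdivrMr.
pose v : n.-tuple R := [tuple 0 | i < n].
have mB := @measurable_closed_eball _ _ v 1.
have lB : lam [set x | edist x v <= 1] = (omega lam)%:E.
  by rewrite (lebesgue_n_eball_gt0 lamE)// expr1n mulr1.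
rewrite -lee_fin -(massE lamE n0 p1 v (c + 1) hA).
rewrite EFinM -lB -integral_cst// [leLHS]integral_mkcond.
apply: ge0_le_integral => //.
- by move=> x _; apply: erestrict_ge0 => y _; rewrite lee_fin (profile_ge0 hA).
- by apply/(measurable_restrictT _ _).1.
- exact: measurable_profile.
- move=> x _; rewrite patchE; case: ifPn => [|_]; last first.
    by rewrite lee_fin (profile_ge0 hA).
  rewrite inE/= => h; rewrite lee_fin; apply: (profile_homo hA).
  rewrite /tent lerBrDr lerD2l.
  rewrite -[leRHS](_ : 1 `^ p = 1); last by rewrite powR1.
  apply: ge0_ler_powR => //.
  + by rewrite (le_trans _ p1).
  + by rewrite nnegrE edist_ge0.
  + by rewrite nnegrE.
Qed.

Lemma kmass_surj a : 0 <= a -> exists2 c, 0 <= c & kmass c = a.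
Proof.
move=> a0; have [M M0 hM] := kmass_unbounded a.
have [] := @IVT R kmass 0 M a M0.
- by apply: continuous_subspaceT => x; exact: kmass_continuous.
- rewrite kmass_le0// min_l ?max_r ?a0 ?hM//; first exact: le_trans hM.
  exact: le_trans hM.
- move=> c; rewrite in_itv/= => /andP[c0 _] cE; by exists c.
Qed.

(* [xget] returns the junk value [0] when [a] is not a mass, i.e. for [a < 0]. *)
Definition level a : R := xget 0 [set c | 0 <= c /\ kmass c = a].

Lemma levelP a : 0 <= a -> 0 <= level a /\ kmass (level a) = a.
Proof.
move=> /kmass_surj[c c0 cE].
by have := @xgetPex _ 0 [set c | 0 <= c /\ kmass c = a] (ex_intro _ c (conj c0 cE)).
Qed.

Lemma level_le a b : 0 <= a -> a < b -> level a <= level b.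
Proof.
move=> a0 ab; have [h1 h2] := levelP a0.
have [h3 h4] := levelP (le_trans a0 (ltW ab)).
rewrite leNgt; apply/negP => /ltW/kmass_homo; rewrite h2 h4; lra.
Qed.

Definition phi a := pcost (level a).

Lemma phi_sandwich a b : 0 <= a -> a <= b ->
  level a * (b - a) <= phi b - phi a <= level b * (b - a).
Proof.
move=> a0; rewrite le_eqVlt => /predU1P[->|ab].
  by rewrite !subrr !mulr0 lexx.
have := pcost_sandwich (level_le a0 ab).
have [_ ->] := levelP a0; have [_ ->] := levelP (le_trans a0 (ltW ab)).
by [].
Qed.

Lemma phiE a : 0 <= a -> phi a = level a * a - cmass (level a).
Proof. by move=> a0; rewrite /phi /pcost; have [_ ->] := levelP a0. Qed.

(** The chosen [level 0] need not be [0], but its mass vanishes, and the sandwich between [0] and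
    this level forces [cmass] to vanish too. *)
Lemma phi0 : phi 0 = 0.
Proof.
have [l0 lE] := levelP (lexx 0).
rewrite phiE// mulr0 sub0r; apply/eqP; rewrite oppr_eq0.
have := cmass_sandwich l0; rewrite lE (kmass_le0 (lexx 0)) mul0r.
have -> : cmass 0 = 0 by exact: mass_le0.
by rewrite subr0 eq_le andbC.
Qed.

Lemma phi_lip a b : 0 <= a <= 1 -> 0 <= b <= 1 ->
  `|phi b - phi a| <= level 1 * `|b - a|.
Proof.
have lev1 x : 0 <= x <= 1 -> level x <= level 1.
  move=> /andP[x0]; rewrite le_eqVlt => /predU1P[->//|x1]; exact: level_le.
wlog ab : a b / a <= b.
  move=> H ha hb; have [ab|/ltW ab] := leP a b; first exact: H.
  by rewrite distrC (distrC b a); exact: H.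
move=> ha hb; have /andP[a0 _] := ha; have /andP[b0 _] := hb.
have /andP[h1 h2] := phi_sandwich a0 ab.
have [l0 _] := levelP a0.
have ba : 0 <= b - a by rewrite subr_ge0.
rewrite !ger0_norm//; last by apply: le_trans h1; exact: mulr_ge0.
by apply: (le_trans h2); apply: ler_wpM2r => //; exact: lev1.
Qed.

Lemma phi_ge0 a : 0 <= a -> 0 <= phi a.
Proof.
move=> a0; have /andP[h _] := phi_sandwich (lexx 0) a0.
have [l0 _] := levelP (lexx 0).
rewrite phi0 !subr0 in h; apply: le_trans h; exact: mulr_ge0.
Qed.

End optimal_cost.
(** * Subadditivity of [phi + g] near the origin *)

Section limn_einf_bounds.
Context {R : realType}.
Implicit Type u : (\bar R)^nat.
Local Open Scope ereal_scope.

Lemma limn_einf_ge u N y : (forall m, (N <= m)%N -> y <= u m) ->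
  y <= limn_einf u.
Proof.
move=> H; rewrite limn_einf_lim.
have -> : limn (einfs u) = ereal_sup (range (einfs u)).
  by apply/cvg_lim => //; exact: cvg_einfs_sup.
apply: (@le_trans _ _ (einfs u N)); last by apply: ereal_sup_ubound; exists N.
by apply: le_ereal_inf_tmp => _ [m /= Nm <-]; exact: H.
Qed.

Lemma limn_einf_gt u y : y < limn_einf u ->
  exists N, forall m, (N <= m)%N -> y < u m.
Proof.
rewrite limn_einf_lim.
have -> : limn (einfs u) = ereal_sup (range (einfs u)).
  by apply/cvg_lim => //; exact: cvg_einfs_sup.
move=> /ereal_sup_gt[_ [N _ <-] yN]; exists N => m Nm.
by apply: (lt_le_trans yN); apply: ereal_inf_lbound; exists m.
Qed.

End limn_einf_bounds.

(* [lim] of a divergent filter is the default point, here [0]. *)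
Lemma derive1_not_derivable {R : realType} (h : R -> R) x :
  ~ derivable h x 1 -> derive1 h x = 0.
Proof.
move=> nd; rewrite derive1E /derive /lim /lim_in getPN// => l hl.
by apply: nd; apply/cvg_ex; exists l.
Qed.

(** * Lower bound for the growth of the mass function *)

Section dini.
Context {R : realType} {n : nat}.
Variable lam : {measure set (n.-tuple R) -> \bar R}.
Hypothesis lamE : is_lebesgue_n lam.
Hypothesis n0 : (0 < n)%N.
Variable p : R.
Hypothesis p1 : 1 <= p.
Variables f k : R -> R.
Hypothesis hf : standing_f f.
Hypothesis hk : is_inv_deriv f k.

Let hA := profile_kp hf hk.
Let w r : R := n%:R * omega lam * r ^+ n.-1.
Let w_ge0 r : 0 <= r -> 0 <= w r.
Proof. by move=> r0; rewrite /w mulr_ge0 ?exprn_ge0// mulr_ge0 ?omega_ge0. Qed.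
Let mw : measurable_fun setT w.
Proof. by apply: measurable_funM => //; apply: measurable_funX. Qed.
Let p0 : 0 <= p. Proof. exact: le_trans p1. Qed.
Local Notation A := (kmass lam p k).

Let mkp c : measurable_fun setT (fun r : R => kp k (c - r `^ p)).
Proof.
apply: measurableT_comp.
  by apply: nondecreasing_measurable => // s t; exact: (profile_homo hA).
by apply: measurable_funB => //; exact: measurable_powR.
Qed.

(** Translates the integral of the hypothesis through c = Rad^p: beyond radius [Rad] the truncated
    profile is zero. *)
Lemma radial_int_kmass Rad : 0 < Rad ->
  radial_int n (omega lam) p k Rad = (A (Rad `^ p))%:E.
Proof.
move=> R0; rewrite /kmass mass_radial// /radial_int.
rewrite [LHS]integral_mkcond [RHS]integral_mkcond.
apply: eq_integral => r _; rewrite !patchE !mem_setE !in_itv/= andbT.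
have [r0|r0] := leP 0 r => //=.
have [rR|rR] := leP r Rad.
  rewrite kpE// subr_ge0 ge0_ler_powR ?nnegrE//; exact: ltW.
rewrite (kp_le0 hk) ?mul0r// subr_le0 ge0_ler_powR ?nnegrE//; exact: ltW.
Qed.

(** Fatou's lemma for the difference quotients [D m] with steps [T m]. A real [q] strictly below the
    integral is used since the latter may be infinite. *)
Lemma kmass_dini Rad q : 0 < Rad ->
  (q%:E < radial_int n (omega lam) p (derive1 k) Rad)%E ->
  forall e, 0 < e -> exists2 t, 0 < t < e &
    q * t <= A (Rad `^ p + t) - A (Rad `^ p).
Proof.
move=> R0 qK e e0; set c := Rad `^ p.
pose T (m : nat) : R := m.+1%:R^-1.
have T0 m : 0 < T m by rewrite invr_gt0.
pose D m (r : R) : R := (T m)^-1 * (kp k (c + T m - r `^ p) - kp k (c - r `^ p)) * w r.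
have D0 m r : 0 <= r -> 0 <= D m r.
  move=> r0; rewrite /D; apply: mulr_ge0; last exact: w_ge0.
  apply: mulr_ge0; first by rewrite invr_ge0 ltW.
  by rewrite subr_ge0; apply: (profile_homo hA); have := T0 m; lra.
have mD m : measurable_fun setT (D m).
  apply: measurable_funM => //; apply: measurable_funM => //.
  exact: measurable_funB.
(* [derive1 k 0] is a junk value, as [k] is unspecified on negative numbers:
   at the single point [r = Rad] the quotients are replaced by its modulus. *)
pose W := `|derive1 k 0 * w Rad|.
pose D' m (r : R) := if r == Rad then W else D m r.
have mR : measurable [set Rad] by exact: measurable_set1.
have mD' m : measurable_fun setT (D' m).
  have -> : D' m = fun r => W * \1_[set Rad] r + D m r * \1_(~` [set Rad]) r.
    apply/funext => r; rewrite /D' !indicE in_setC; case: eqVneq => [->|rR].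
      by rewrite mem_set// mulr1 mulr0 addr0.
    rewrite memNset; last by apply/eqP.
    by rewrite mulr0 mulr1 add0r.
  apply: measurable_funD; apply: measurable_funM => //; apply: measurable_indic => //.
  exact: measurableC.
have mDE (X : set R) m : @measurable_fun _ _ (measurableTypeR R) _ X (fun r => (D m r)%:E).
  apply/measurable_EFinP; apply: (@measurable_funTS _ _ (measurableTypeR R)).
  exact: mD.
have mDE' (X : set R) m : @measurable_fun _ _ (measurableTypeR R) _ X (fun r => (D' m r)%:E).
  apply/measurable_EFinP; apply: (@measurable_funTS _ _ (measurableTypeR R)).
  exact: mD'.
have eqD m : (\int[lebesgue_measure]_(r in `[0%R, Rad]) (D' m r)%:E =
              \int[lebesgue_measure]_(r in `[0%R, Rad]) (D m r)%:E)%E.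
  have mI : measurable (`[0%R, Rad]%classic `\ Rad) by exact: measurableD.
  rewrite -(@integral_setD1 R (fun r => (D' m r)%:E) Rad _ mI (mDE' _ m)).
  rewrite -(@integral_setD1 R (fun r => (D m r)%:E) Rad _ mI (mDE _ m)).
  apply: eq_integral => r; rewrite inE => -[_ /eqP rR].
  by rewrite /D' (negbTE rR).
have leD m : (\int[lebesgue_measure]_(r in `[0%R, Rad]) (D m r)%:E <=
              \int[lebesgue_measure]_(r in `[0%R, +oo[) (D m r)%:E)%E.
  apply: ge0_subset_integral => //.
  - by move=> r; rewrite /= in_itv/= andbT lee_fin; exact: D0.
  - by move=> r; rewrite /= !in_itv/= andbT => /andP[].
have intD m : ((A (c + T m))%:E = (T m)%:E *
    \int[lebesgue_measure]_(r in `[0%R, +oo[) (D m r)%:E + (A c)%:E)%E.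
  rewrite /kmass !mass_radial// -ge0_integralZl//; last 2 first.
  - by move=> r; rewrite /= in_itv/= andbT lee_fin; exact: D0.
  - by rewrite lee_fin ltW.
  rewrite -ge0_integralD//; last 4 first.
  - move=> r; rewrite /= in_itv/= andbT -EFinM lee_fin => r0.
    by rewrite mulr_ge0 ?D0// ltW.
  - exact: emeasurable_funM.
  - move=> r; rewrite /= in_itv/= andbT lee_fin => r0.
    by rewrite mulr_ge0 ?(profile_ge0 hA)//; exact: w_ge0.
  - apply/measurable_EFinP; apply: (@measurable_funTS _ _ (measurableTypeR R)).
    by apply: (@measurable_funM _ (measurableTypeR R)); [exact: mkp|exact: mw].
  apply: eq_integral => r _; rewrite -EFinM -EFinD; congr (_%:E).
  rewrite /D -/(w r); field.
  by rewrite gt_eqF.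
have F := @fatou _ _ _ lebesgue_measure `[0%R, Rad]%classic (measurable_itv _)
  (fun m r => (D' m r)%:E).
have {}F : (radial_int n (omega lam) p (derive1 k) Rad <=
    limn_einf (fun m => \int[lebesgue_measure]_(r in `[0%R, Rad]) (D' m r)%:E))%E.
  apply: le_trans (F _ _); last 2 first.
    by [].
    move=> m r; rewrite /= in_itv/= => /andP[r0 _]; rewrite lee_fin /D'.
    by case: ifP => // _; first exact: normr_ge0; apply: D0.
  rewrite /radial_int.
  (* The sign of [derive1 k 0], met at [r = Rad], is unknown; passing to the positive part makes the
     comparison one between nonnegative functions. *)
  apply: (@le_trans _ _ (\int[lebesgue_measure]_(r in `[0%R, Rad])
     ((fun r => (derive1 k (Rad `^ p - r `^ p) * (n%:R * omega lam * r ^+ n.-1))%:E)^\+ r))%E).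
    rewrite [leLHS]integralE -[leRHS]adde0; apply: leeD => //; rewrite oppe_le0; by apply: integral_ge0.
  apply: ge0_le_integral_nomeas => // r; rewrite /= in_itv/= => /andP[r0 rR].
  rewrite funeposE ge_max -/(w r) -/c; apply/andP; split; last first.
    apply: (@limn_einf_ge _ _ 0%N) => m _; rewrite lee_fin /D'.
    by case: ifP => // _; first exact: normr_ge0; apply: D0.
  move: rR; rewrite le_eqVlt => /predU1P[->|rR].
    apply: (@limn_einf_ge _ _ 0%N) => m _; rewrite lee_fin /D' eqxx.
    by rewrite subrr ler_norm.
  have D'E m : D' m r = D m r by rewrite /D' lt_eqF.
  set s := c - r `^ p.
  have s0 : 0 < s.
    rewrite subr_gt0 /c gt0_ltr_powR ?nnegrE//; [exact: lt_le_trans p1|exact: ltW].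
  (* Where [k] is not differentiable the integrand is [0] by default, and the quotients are
     nonnegative by monotonicity. *)
  have [dk|/derive1_not_derivable ->] := pselect (derivable k s 1); last first.
    apply: (@limn_einf_ge _ _ 0%N) => m _; rewrite lee_fin mul0r D'E.
    exact: D0.
  apply/lee_addgt0Pr => e' e'0.
  have w1 : 0 < w r + 1 by rewrite ltr_wpDl// w_ge0.
  (* Dividing by [w r + 1], which is positive even if [w r = 0], keeps the error below [e'] after
     multiplication by the weight. *)
  have [d d0 hd] := derivable_epsilon dk (divr_gt0 e'0 w1).
  rewrite -leeBlDr//.
  apply: (@limn_einf_ge _ _ (Num.truncn d^-1)) => m mN.
  have Td : T m < d.
    rewrite /T invf_plt ?posrE//; apply: (lt_le_trans (truncnS_gt _)).
    by rewrite ler_nat.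
  rewrite D'E -EFinB lee_fin /D.
  have -> : c + T m - r `^ p = s + T m by rewrite /s; ring.
  rewrite -/s [kp k s]kpE ?(ltW s0)// kpE; last by rewrite addr_ge0// ltW.
  have := hd (T m); rewrite gtr0_norm// => /(_ Td).
  rewrite ler_norml => /andP[h1 _].
  set Q := _^-1 * _.
  have QE : Q * T m = k (s + T m) - k s by rewrite /Q; field; rewrite gt_eqF.
  have h2 : derive1 k s - e' / (w r + 1) <= Q.
    rewrite -(ler_pM2r (T0 m)) QE; lra.
  have h3 : e' / (w r + 1) * w r <= e'.
    rewrite mulrAC ler_pdivrMr// ler_wpM2l ?(ltW e'0)//; lra.
  have := ler_wpM2r (w_ge0 r0) h2; lra.
have [N hN] := limn_einf_gt (lt_le_trans qK F).
pose m := maxn N (Num.truncn e^-1).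
exists (T m).
  rewrite T0 /T invf_plt ?posrE//; apply: (lt_le_trans (truncnS_gt _)).
  by rewrite ler_nat ltnS leq_maxr.
rewrite lerBrDr -lee_fin intD EFinD leeD2r// EFinM muleC lee_wpmul2l//.
  by rewrite lee_fin ltW.
by apply: le_trans (leD m); rewrite -eqD ltW// hN// leq_maxl.
Qed.

End dini.

(** * Extension from the unit interval, and a monotonicity criterion *)

Section clamp.
Context {R : realType}.

(** A retraction onto the unit interval: composing with it turns continuity on [[0, 1]] into
    continuity on the whole line. *)
Definition clamp (t : R) : R := Num.max 0 (Num.min t 1).

Lemma clamp_itv t : 0 <= clamp t <= 1.
Proof. by rewrite /clamp le_max lexx /= ge_max ler01 ge_min lexx orbT. Qed.

Lemma clampE t : 0 <= t <= 1 -> clamp t = t.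
Proof. by move=> /andP[t0 t1]; rewrite /clamp min_l// max_r. Qed.

Lemma clamp_lip x y : `|clamp x - clamp y| <= `|x - y|.
Proof.
have h1 := ler_norm (x - y).
have h2 : - (x - y) <= `|x - y| by rewrite -normrN ler_norm.
rewrite ler_norml /clamp.
case: (leP x 1) => hx; case: (leP y 1) => hy;
case: (leP 0 x) => hx0; case: (leP 0 y) => hy0;
by rewrite ?(max_r ler01); apply/andP; split; lra.
Qed.

Lemma lipschitz_continuous (u : R -> R) L :
  (forall x y, `|u x - u y| <= L * `|x - y|) -> continuous u.
Proof.
move=> H x; apply/cvgrPdist_le => e e0.
have L0 : 0 < `|L| + 1 by rewrite ltr_wpDl.
apply/nbhs_ballP; exists (e / (`|L| + 1)) => /=; first by rewrite divr_gt0.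
move=> y; rewrite /ball/= => /ltW; rewrite ler_pdivlMr// => h.
apply: (le_trans (H x y)); apply: le_trans h; rewrite mulrC ler_wpM2l//.
by rewrite (le_trans (ler_norm L))// lerDl.
Qed.

Lemma clamp_continuous : continuous clamp.
Proof. by apply: (@lipschitz_continuous _ 1) => x y; rewrite mul1r clamp_lip. Qed.

Lemma continuous_clamp_comp (g : R -> R) :
  {within `[0, 1], continuous g} -> continuous (g \o clamp).
Proof.
move=> /subspace_continuousP cg x.
have xI : `[0, 1]%classic (clamp x) by rewrite /= in_itv/= clamp_itv.
apply: cvg_trans (cg _ xI); rewrite /= => P /=.
rewrite /nbhs/= => WP.
apply: (@filterS _ (nbhs x) _ (fun y => `[0, 1]%classic (clamp y) -> P (g (clamp y)))).
  by move=> y; apply; rewrite /= in_itv/= clamp_itv.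
exact: (clamp_continuous WP).
Qed.

End clamp.

(** The supremum of the points where [u] is at most [u a] is such a point by continuity, and a step
    to the right of it would contradict maximality unless it is [b]. *)
Lemma nonincreasing_right_step {R : realType} (u : R -> R) (a b : R) : a <= b ->
  (forall x, a <= x <= b -> {for x, continuous u}) ->
  (forall x, a <= x < b -> exists2 y, x < y <= b & u y <= u x) ->
  u b <= u a.
Proof.
move=> ab cu step; pose S := [set x | a <= x <= b /\ u x <= u a].
have Sa : S a by split; rewrite ?lexx.
have hS : has_sup S by split; [exists a|exists b => x [/andP[]]].
have ubS : ubound S (sup S) by exact: sup_upper_bound.
have as_ : a <= sup S by exact: ubS.
have sb : sup S <= b by apply: ge_sup; [exists a|move=> x [/andP[]]].
have uS : u (sup S) <= u a.
  rewrite leNgt; apply/negP => us.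
  have /cvgrPdist_lt : {for sup S, continuous u} by apply: cu; rewrite as_.
  move=> /(_ (u (sup S) - u a)); rewrite subr_gt0 => /(_ us).
  move=> /nbhs_ballP[e /= e0 he].
  have [x Sx xs] := sup_adherent e0 hS.
  have xle := ubS _ Sx.
  have /he : ball (sup S) e x.
    by rewrite /ball /= ger0_norm ?subr_ge0//; lra.
  have [_ ux] := Sx.
  by rewrite ltr_norml => /andP[_]; lra.
move: sb; rewrite le_eqVlt => /predU1P[<-//|sb].
have [|y /andP[sy yb] uy] := step (sup S); first by rewrite as_.
have : S y by split; [rewrite yb andbT (le_trans as_ (ltW sy))|exact: le_trans uS].
by move=> /ubS; rewrite leNgt sy.
Qed.

(** * Monotonicity of the slope of [phi + g] *)

Section concavity.
Context {R : realType} {n : nat}.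
Variable lam : {measure set (n.-tuple R) -> \bar R}.
Hypothesis lamE : is_lebesgue_n lam.
Hypothesis n0 : (0 < n)%N.
Variable p : R.
Hypothesis p1 : 1 <= p.
Variables f k g : R -> R.
Hypothesis hf : standing_f f.
Hypothesis hk : is_inv_deriv f k.
Hypothesis hg : hyp_g g.

Local Notation A := (kmass lam p k).
Local Notation K := (radial_int n (omega lam) p (derive1 k)).

Variable R0 : R.
Hypothesis R0_gt0 : 0 < R0.
Hypothesis HR : forall Rad, 0 < Rad < R0 ->
  ((derive1n 2 g (fine (radial_int n (omega lam) p k Rad)))%:E * K Rad < (-1)%:E)%E.

(** If the unit ball were null, the integral of [derive1 k] would vanish and the product in [HR]
    would be [0]. *)
Lemma omega_gt0 : 0 < omega lam.
Proof.
rewrite lt_neqAle omega_ge0 andbT eq_sym; apply/eqP => om0.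
have h : 0 < R0 / 2 < R0 by move: R0_gt0 => R0p; apply/andP; split; lra.
have := HR h; rewrite /radial_int om0.
rewrite (_ : (fun r => _) = cst 0%E); last first.
  by apply/funext => r; rewrite mulr0 mul0r mulr0.
rewrite (_ : (\int[_]_(r in _) (derive1 k _ * _)%:E = 0)%E); last first.
  by apply: integral0_eq => r _; rewrite mulr0 mul0r mulr0.
by rewrite mule0 lte_fin; lra.
Qed.

Let om0 := omega_gt0.
Let hA := profile_kp hf hk.
Let Ahomo := kmass_homo lamE n0 p1 hf hk.
Let Acont := kmass_continuous lamE p1 hf hk.

Lemma derive1_inv_deriv_ge0 s : 0 < s -> 0 <= derive1 k s.
Proof.
move=> s0; have [dk|/derive1_not_derivable->//] := pselect (derivable k s 1).
apply/ler_addgt0Pr => e e0.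
have [d d0 hd] := derivable_epsilon dk e0.
have h0 : 0 < d / 2 by rewrite divr_gt0.
have := hd (d / 2); rewrite gtr0_norm// => /(_ ltac:(lra)).
rewrite ler_norml => /andP[_ h1].
have h2 : k s <= k (s + d / 2) by apply: (inv_deriv_le hf hk); lra.
rewrite -(pmulr_lge0 _ h0); lra.
Qed.

(** The integrand is nonnegative for [r < Rad]; its negative part is carried by the point [Rad], a
    null set. *)
Lemma radial_int_derive_ge0 Rad : 0 < Rad -> (0 <= K Rad)%E.
Proof.
move=> Rad0.
pose F (r : R) : \bar R :=
  (derive1 k (Rad `^ p - r `^ p) * (n%:R * omega lam * r ^+ n.-1))%:E.
have -> : K Rad = (\int[lebesgue_measure]_(r in `[0%R, Rad]) F r)%E by [].
rewrite integralE.
suff -> : (\int[lebesgue_measure]_(r in `[0%R, Rad]) (F^\- r) = 0)%E.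
  by rewrite sube0; exact: integral_ge0.
apply/eqP; rewrite eq_le; apply/andP; split; last exact: integral_ge0.
have mR : measurable [set Rad] by exact: measurable_set1.
pose W := `|fine (F Rad)|.
apply: (@le_trans _ _ (\int[lebesgue_measure]_(r in [set Rad]) W%:E)%E); last first.
  by rewrite integral_set1.
rewrite [leLHS]integral_mkcond [leRHS]integral_mkcond.
apply: ge0_le_integral_nomeas => r _; first by apply: erestrict_ge0.
rewrite !patchE; case: ifPn; last first.
  by move=> _; case: ifPn => // _; rewrite lee_fin normr_ge0.
rewrite inE/= in_itv/= => /andP[r0 rR].
have [rE|rNE] := eqVneq r Rad.
  rewrite mem_set// funenegE ge_max rE /F -EFinN !lee_fin /W /F/=.
  by rewrite -normrN ler_norm normr_ge0.
rewrite memNset; last by apply/eqP.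
rewrite funenegE ge_max lexx andbT /F leeNl oppe0 lee_fin.
apply: mulr_ge0; last by rewrite mulr_ge0 ?exprn_ge0// mulr_ge0 ?omega_ge0.
apply: derive1_inv_deriv_ge0; rewrite subr_gt0 gt0_ltr_powR ?nnegrE//.
- exact: lt_le_trans p1.
- exact: ltW.
- by rewrite lt_neqAle rNE.
Qed.

Let c0 := R0 `^ p.

(** As [K] is nonnegative, a product below [-1] forces the second derivative of [g] to be negative
    and [K] to exceed the inverse of its opposite. The real [q] is chosen strictly in between. *)
Let dini2 c : 0 < c < c0 -> exists q, [/\ 0 < q,
  1 < - derive1n 2 g (A c) * q &
  forall e, 0 < e -> exists2 t, 0 < t < e & q * t <= A (c + t) - A c].
Proof.
move=> /andP[cp cc0]; have pp : 0 < p by exact: lt_le_trans p1.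
pose Rad := c `^ p^-1.
have RadE : Rad `^ p = c by rewrite /Rad -powRrM mulVf ?gt_eqF// powRr1// ltW.
have Rad0 : 0 < Rad by exact: powR_gt0.
have RadR0 : Rad < R0.
  rewrite ltNge; apply/negP => h.
  suff : R0 `^ p <= Rad `^ p by rewrite RadE leNgt cc0.
  by apply: ge0_ler_powR => //; rewrite ?nnegrE; exact: ltW.
have := HR (introT andP (conj Rad0 RadR0)).
rewrite (radial_int_kmass lamE n0 p1 hf hk)// RadE/=.
have K0 := radial_int_derive_ge0 Rad0.
set G := derive1n 2 g (A c); set L := K Rad in K0 *.
move=> GL.
have G0 : G < 0.
  rewrite ltNge; apply/negP => G0.
  have : (0 <= G%:E * L)%E by apply: mule_ge0.
  by move=> /le_lt_trans /(_ GL); rewrite lte_fin; lra.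
have Gp : 0 < - G by rewrite oppr_gt0.
have LG : ((- G)^-1%:E < L)%E.
  rewrite ltNge; apply/negP => h.
  have : ((- G)%:E * L <= (- G)%:E * (- G)^-1%:E)%E.
    by apply: lee_wpmul2l => //; rewrite lee_fin ltW.
  rewrite -EFinM divff ?gt_eqF// EFinN mulNe leeNl => /le_lt_trans/(_ GL).
  by rewrite lte_fin ltxx.
have [q q1 qL] : exists2 q, (- G)^-1 < q & (q%:E < L)%E.
  move: LG; case: L {GL K0} => [l| |].
  - rewrite lte_fin => h; exists (((- G)^-1 + l) / 2); rewrite ?lte_fin; lra.
  - move=> _; exists ((- G)^-1 + 1); rewrite ?ltry//; lra.
  - by rewrite ltNge leNye.
exists q; split.
- by apply: lt_trans q1; rewrite invr_gt0.
- by rewrite -ltr_pdivrMl// mulr1.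
- move=> e e0; have [t t0 ht] := kmass_dini lamE n0 p1 hf hk Rad0 qL e0.
  by exists t => //; rewrite RadE in ht.
Qed.

Let A_strict c c' : 0 < c -> c < c' -> c < c0 -> A c < A c'.
Proof.
move=> cp cc' cc0; have [q [q0 _ hq]] := dini2 (introT andP (conj cp cc0)).
have [|t /andP[t0 tc] ht] := hq (c' - c); first by rewrite subr_gt0.
apply: lt_le_trans (Ahomo (_ : c + t <= c')); last by lra.
by rewrite -subr_gt0 (lt_le_trans _ ht)// mulr_gt0.
Qed.

Let A_gt0 c : 0 < c -> 0 < A c.
Proof.
move=> cp; pose x := Num.min (c / 2) (c0 / 2).
have c0p : 0 < c0 by exact: powR_gt0.
have x0 : 0 < x by rewrite lt_min !divr_gt0.
have xc : x < c by rewrite gt_min; apply/orP; left; lra.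
have xc0 : x < c0 by rewrite gt_min; apply/orP; right; lra.
by apply: le_lt_trans (A_strict x0 xc xc0); exact: mass_ge0.
Qed.

(** Levels up to [c1] have masses in [[0, 1]], where [g] is controlled. *)
Let ex_c1 : exists2 c1, 0 < c1 < c0 & A c1 <= 1.
Proof.
have c0p : 0 < c0 by exact: powR_gt0.
have cA : {for 0, continuous A} by exact: Acont.
have /cvgrPdist_le/(_ 1 ltr01) := cA.
move=> /nbhs_ballP[e /= e0 he].
pose x := Num.min (e / 2) (c0 / 2).
have x0 : 0 < x by rewrite lt_min !divr_gt0.
have xe : x < e by rewrite gt_min; apply/orP; left; lra.
have xc0 : x < c0 by rewrite gt_min; apply/orP; right; lra.
exists x; first by rewrite x0.
have /he : ball 0 e x by rewrite /ball /= sub0r normrN gtr0_norm.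
by rewrite (kmass_le0 lam p hf hk (lexx 0)) sub0r normrN ger0_norm// ltW// A_gt0.
Qed.

Let psi c := c + derive1 g (A c).

Let dg x : 0 < x <= 1 -> derivable g x 1 /\ derivable (derive1 g) x 1.
Proof. by case: hg => _ [_ [_ [_ [_ [_ [h _]]]]]]; exact: h. Qed.

Let psi_step c : 0 < c < c0 -> A c <= 1 -> forall e, 0 < e ->
  exists2 t, 0 < t < e & psi (c + t) <= psi c.
Proof.
move=> cc Ac1 e e0; have [q [q0 hq ht]] := dini2 cc.
have /andP[cp _] := cc.
have [_ dg2] := dg (introT andP (conj (A_gt0 cp) Ac1)).
set G := derive1n 2 g (A c) in hq *.
(* With this tolerance, [G] plus the error is [- q^-1]: as the mass grows by [D >= q * t],
   [derive1 g] drops by at least [q^-1 * D >= t], which offsets the rise [t] of the level. *)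
have eps0 : 0 < - G - q^-1.
  by rewrite subr_gt0 -(ltr_pM2r q0) mulVf ?gt_eqF.
have [d d0 hd] := derivable_epsilon dg2 eps0.
have cA : {for c, continuous A} by exact: Acont.
have /cvgrPdist_lt/(_ d d0)/nbhs_ballP[e1 /= e10 he1] := cA.
have [|t /andP[t0 te] hqt] := ht (Num.min e e1); first by rewrite lt_min e0.
move: te; rewrite lt_min => /andP[te te1].
exists t; first by rewrite t0.
pose D := A (c + t) - A c.
have D0 : 0 < D by apply: lt_le_trans hqt; rewrite mulr_gt0.
have Dd : `|D| < d.
  rewrite distrC; apply: he1.
  by rewrite /ball/= opprD addNKr normrN gtr0_norm.
have := hd D Dd; rewrite (_ : A c + D = A (c + t)); last by rewrite /D; ring.
have -> : derive1 (derive1 g) (A c) = G by rewrite /G derive1nS.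
rewrite (gtr0_norm D0) ler_norml => /andP[_ h].
have tD : t <= q^-1 * D by rewrite ler_pdivlMl.
rewrite /psi; lra.
Qed.

Let psi_noninc c1 a b : c1 < c0 -> A c1 <= 1 ->
  0 < a -> a <= b -> b < c1 -> psi b <= psi a.
Proof.
move=> c1c0 Ac1 a0 ab bc1; apply: nonincreasing_right_step => //.
  move=> x /andP[ax xb].
  apply: (@cvgD _ _ _ _ _ id (fun c => derive1 g (A c))); first exact: cvg_id.
  apply: (@continuous_comp _ _ _ A); first exact: Acont.
  apply: differentiable_continuous; apply/derivable1_diffP.
  have Ax : 0 < A x <= 1.
    rewrite A_gt0 ?(lt_le_trans a0)//=; apply: le_trans Ac1; apply: Ahomo.
    exact: le_trans (ltW bc1).
  by have [] := dg Ax.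
move=> x /andP[ax xb].
have xI : 0 < x < c0.
  by rewrite (lt_le_trans a0)//=; apply: lt_trans c1c0; exact: lt_trans bc1.
have Ax1 : A x <= 1.
  by apply: le_trans Ac1; apply: Ahomo; apply: ltW; exact: lt_trans bc1.
have bx0 : 0 < b - x by rewrite subr_gt0.
have [t /andP[t0 tb] ht] := psi_step xI Ax1 bx0.
by exists (x + t) => //; apply/andP; split; lra.
Qed.

Local Notation level := (level lam p k).
Local Notation phi := (phi lam p f k).
Definition hcost a := phi a + g a.
Let levP := levelP lamE n0 p1 hf hk om0.

Let level_gt0 a : 0 < a -> 0 < level a.
Proof.
move=> a0; have [l0 lE] := levP (ltW a0).
rewrite lt_neqAle l0 andbT; apply/eqP => h.
by move: a0; rewrite -lE -h (kmass_le0 lam p hf hk (lexx 0)) ltxx.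
Qed.

Let level_lt a c : 0 <= a -> a < A c -> level a < c.
Proof.
move=> a0 aA; have [l0 lE] := levP a0.
by rewrite ltNge; apply/negP => /Ahomo; rewrite lE leNgt aA.
Qed.

Let level_gt a c : 0 <= a -> A c < a -> c < level a.
Proof.
move=> a0 aA; have [l0 lE] := levP a0.
by rewrite ltNge; apply/negP => /Ahomo; rewrite lE leNgt aA.
Qed.

(** [phi_sandwich] encloses the difference quotient between the levels of [a] and [a + y], and
    strict monotonicity of the mass function brings these levels together. *)
Let phi_derive c1 a : c1 < c0 -> 0 < a < A c1 -> is_derive a (1 : R) phi (level a).
Proof.
move=> c1c0 /andP[a0 aA]; apply: is_derive_epsilon => e e0.
have [l0 lE] := levP (ltW a0).
have lp := level_gt0 a0; have lc := level_lt (ltW a0) aA.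
(* Keeps [level a - e'] positive and [level a + e'] below [c1], where [A_strict] applies. The masses
   at these two levels then enclose [a], and their gaps to [a] give the radius [d] below. *)
pose e' := Num.min e (Num.min (level a / 2) ((c1 - level a) / 2)).
have e'0 : 0 < e' by rewrite !lt_min e0 !divr_gt0// subr_gt0.
have e'e : e' <= e by rewrite ge_min lexx.
have e'l : e' <= level a / 2 by rewrite !ge_min lexx !orbT.
have e'c : e' <= (c1 - level a) / 2 by rewrite !ge_min lexx !orbT.
have h1 : A (level a - e') < a by rewrite -[X in _ < X]lE; apply: A_strict; lra.
have h2 : a < A (level a + e') by rewrite -[X in X < _]lE; apply: A_strict; lra.
pose d := Num.min a (Num.min (a - A (level a - e')) (A (level a + e') - a)).
have d0 : 0 < d by rewrite !lt_min a0 !subr_gt0 h1 h2.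
exists d => // y; rewrite !lt_min !ltr_norml => /andP[/andP[y1 _] /andP[/andP[y2 _] /andP[_ y3]]].
have b0 : 0 <= a + y by lra.
have L1 : level (a + y) < level a + e' by apply: level_lt => //; lra.
have L2 : level a - e' < level (a + y) by apply: level_gt => //; lra.
have [y0|y0] := leP 0 y.
  have ay : a <= a + y by lra.
  have /andP[] := phi_sandwich lamE n0 p1 hf hk om0 (ltW a0) ay.
  rewrite (_ : a + y - a = y); last by ring.
  move=> s1 s2; rewrite (ger0_norm y0) ler_norml; apply/andP; split; nra.
have ay : a + y <= a by lra.
have /andP[] := phi_sandwich lamE n0 p1 hf hk om0 b0 ay.
rewrite (_ : a - (a + y) = - y); last by ring.
move=> s1 s2; rewrite (ltr0_norm y0) ler_norml; apply/andP; split; nra.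
Qed.

Lemma phi_clamp_continuous : continuous (phi \o clamp).
Proof.
apply: (@lipschitz_continuous _ _ (level 1)) => x y /=.
have [l _] := levP ler01.
apply: (le_trans (phi_lip lamE n0 p1 hf hk om0 (clamp_itv y) (clamp_itv x))).
by apply: ler_wpM2l => //; exact: clamp_lip.
Qed.

Lemma hcost_clamp_continuous : continuous (hcost \o clamp).
Proof.
move=> x; apply: (@cvgD _ _ _ _ _ (phi \o clamp) (g \o clamp)).
  exact: phi_clamp_continuous.
apply: continuous_clamp_comp.
by case: hg => _ [_ [_ [_ [_ []]]]].
Qed.

Lemma hcost0 : hcost 0 = 0.
Proof.
rewrite /hcost (phi0 lamE n0 p1 hf hk om0) add0r.
by case: hg => _ [_ [_ []]].
Qed.

Let hcost_within a b : 0 <= a -> b <= 1 -> {within `[a, b], continuous hcost}.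
Proof.
move=> a0 b1; apply: (@subspace_eq_continuous _ _ _ (hcost \o clamp)).
  move=> x; rewrite inE/= in_itv/= => /andP[ax xb].
  by rewrite clampE// (le_trans a0 ax) (le_trans xb b1).
by apply: continuous_subspaceT => x; exact: hcost_clamp_continuous.
Qed.

(** For [s <= t], the mean value theorem on [[0, s]] and on [[t, s + t]], intervals of the same
    length, compares slopes at interior points [x < y]; the origin, where the slope of [g] blows up,
    is avoided. *)
Lemma hcost_subadditive : exists2 d, 0 < d & forall s t, 0 <= s -> 0 <= t ->
  s + t <= d -> hcost (s + t) <= hcost s + hcost t.
Proof.
have [c1 /andP[c10 c1c0] Ac1] := ex_c1.
exists (A c1); first exact: A_gt0.
have D a : 0 < a < A c1 -> is_derive a (1 : R) hcost (psi (level a)).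
  move=> /[dup] aI /andP[a0 aA]; have [_ lE] := levP (ltW a0).
  rewrite /psi lE.
  have D1 := phi_derive c1c0 aI.
  have D2 : is_derive a (1 : R) g (derive1 g a).
    have a1 : 0 < a <= 1 by rewrite a0 (le_trans (ltW aA)).
    have [dga _] := dg a1.
    by rewrite derive1E; exact/derivableP.
  exact: is_deriveD.
move=> s t; wlog st : s t / s <= t.
  move=> H s0 t0; have [st|/ltW ts] := leP s t; first exact: H.
  by move=> stA; rewrite addrC [leRHS]addrC; apply: H => //; rewrite addrC.
rewrite le_eqVlt => /predU1P[<- t0 _|s0 t0 stA].
  by rewrite add0r hcost0 add0r.
have [||x] := @MVT R hcost (fun a => psi (level a)) 0 s s0.
- move=> x; rewrite in_itv/= => /andP[x0 xs]; apply: D; rewrite x0/=; lra.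
- by apply: hcost_within => //; apply: le_trans Ac1; lra.
rewrite in_itv/= => /andP[x0 xs]; rewrite hcost0 !subr0 => xE.
have [|||y] := @MVT R hcost (fun a => psi (level a)) t (s + t).
- lra.
- move=> y; rewrite in_itv/= => /andP[ty ys]; apply: D; apply/andP; split; lra.
- by apply: hcost_within => //; exact: le_trans Ac1.
rewrite in_itv/= => /andP[ty ys]; rewrite addrK => yE.
have yx : psi (level y) <= psi (level x).
  have xy : x < y by lra.
  apply: (psi_noninc c1c0 Ac1); first exact: level_gt0.
    by apply: (level_le lamE n0 p1 hf hk om0) => //; exact: ltW.
  by apply: level_lt; lra.
have := ler_wpM2r (ltW s0) yx; lra.
Qed.

End concavity.
(** * Minimisation over finite families of masses *)

Section discrete_minimisation.
Context {R : realType}.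
Variable h : R -> R.
Hypothesis h0 : h 0 = 0.
Hypothesis h_cont : continuous (h \o clamp).
Variable d : R.
Hypothesis d0 : 0 < d.
Hypothesis h_sub : forall s t, 0 <= s -> 0 <= t -> s + t <= d -> h (s + t) <= h s + h t.

(** At most [M] parts of a unit mass exceed [d / 2], so any [M + 2] parts contain two whose sum is
    at most [d]. *)
Let M := Num.truncn (d / 2)^-1.

Let small_pair (s : seq R) : (forall x, x \in s -> 0 <= x) ->
  \sum_(x <- s) x = 1 -> (M.+1 < size s)%N ->
  exists x y r, [/\ perm_eq s (x :: y :: r), x + y <= d & 0 <= x /\ 0 <= y].
Proof.
move=> s0 s1 sM; pose P x := d / 2 < x.
have d2 : 0 < d / 2 by rewrite divr_gt0.
have cP : (count P s <= M)%N.
  rewrite /M truncn_ge_nat; last by rewrite invr_ge0 ltW.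
  rewrite -(ler_pM2r d2) mulVf ?gt_eqF// -[leRHS]s1.
  rewrite [leLHS](_ : _ = \sum_(x <- s | P x) (d / 2)); last first.
    by rewrite big_const_seq iter_addr_0 mulr_natl.
  rewrite [leRHS](bigID P)/= -[leLHS]addr0; apply: lerD.
    by apply: ler_sum => x /ltW.
  by rewrite big_seq_cond; apply: sumr_ge0 => x /andP[/s0].
have : (1 < size (seq.filter (predC P) s))%N.
  rewrite size_filter -(leq_add2l (count P s)) count_predC addn2.
  by apply: leq_trans sM; rewrite !ltnS.
have pe : perm_eq s (seq.filter (predC P) s ++ seq.filter P s).
  by rewrite perm_sym perm_catC; apply/permPl/perm_filterC.
case E : (seq.filter (predC P) s) => [|x [|y r]]// _.
have hx : x \in seq.filter (predC P) s by rewrite E mem_head.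
have hy : y \in seq.filter (predC P) s by rewrite E !inE eqxx orbT.
move: hx hy; rewrite !mem_filter /= /P -!leNgt => /andP[xd xs] /andP[yd ys].
exists x, y, (r ++ seq.filter P s); split.
- by rewrite E in pe.
- lra.
- by split; exact: s0.
Qed.

Lemma merge_small (s : seq R) : (forall x, x \in s -> 0 <= x) ->
  \sum_(x <- s) x = 1 -> exists s' : seq R,
  [/\ (size s' <= M.+1)%N, forall x, x \in s' -> 0 <= x,
      \sum_(x <- s') x = 1 & \sum_(x <- s') h x <= \sum_(x <- s) h x].
Proof.
move: {2}(size s) (leqnn (size s)) => m; elim: m s => [|m IH] s sm s0 s1.
  by exists s; split => //; exact: leq_trans sm _.
have [sM|sM] := leqP (size s) M.+1; first by exists s.
have [x [y [r [pe xyd [x0 y0]]]]] := small_pair s0 s1 sM.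
have r0 z : z \in r -> 0 <= z.
  by move=> zr; apply: s0; rewrite (perm_mem pe) !inE zr !orbT.
have [||| s' [H1 H2 H3 H4]] := IH (x + y :: r).
- by move: sm; rewrite (perm_size pe).
- by move=> z; rewrite inE => /predU1P[->|/r0//]; exact: addr_ge0.
- by rewrite -s1 (perm_big _ pe)/= !big_cons addrA.
exists s'; split => //; apply: (le_trans H4).
rewrite (perm_big _ pe)/= !big_cons addrA lerD2r.
exact: h_sub.
Qed.

Lemma continuous_sum (I : Type) (T : topologicalType) (s : seq I) (F : I -> T -> R) :
  (forall i, continuous (F i)) -> continuous (fun x => \sum_(i <- s) F i x).
Proof.
move=> cF; elim: s => [|i s IH] x.
  by under eq_fun do rewrite big_nil; exact: cvg_cst.
under eq_fun do rewrite big_cons.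
by apply: cvgD; [exact: cF|exact: IH].
Qed.

(** A continuous function on the simplex with [M + 1] coordinates has a minimum; merged lists that
    are shorter are padded with zeros, which cost nothing since [h 0 = 0]. *)
Lemma discrete_min : exists N (a : 'I_N.+1 -> R), [/\ forall i, 0 <= a i,
  \sum_i a i = 1 & forall s : seq R, (forall x, x \in s -> 0 <= x) ->
    \sum_(x <- s) x = 1 -> \sum_i h (a i) <= \sum_(x <- s) h x].
Proof.
pose S : set 'rV[R]_M.+1 :=
  [set v | (forall i, v ord0 i \in `[0, 1]) /\ \sum_i v ord0 i = 1].
have cS : compact S.
  have -> : S = [set v : 'rV[R]_M.+1 | forall i, `[0, 1]%classic (v ord0 i)] `&`
      (fun v : 'rV[R]_M.+1 => \sum_i v ord0 i) @^-1` [set 1].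
    by apply/seteqP; split => v.
  apply: compact_closedI.
    by apply: (@rV_compact R M.+1 (fun=> `[0, 1]%classic)) => i; exact: segment_compact.
  apply: (@closed_comp _ _ (fun v : 'rV[R]_M.+1 => \sum_i v ord0 i) [set 1]).
    by move=> v _; apply: (@continuous_sum _ _ _ (fun i (v : 'rV[R]_M.+1) => v ord0 i)) => i;
      exact: coord_continuous.
  exact: closed_eq.
have SN : S !=set0.
  exists (\row_i (i == ord0)%:R); split.
    by move=> i; rewrite mxE in_itv/=; case: (_ == _); rewrite ?lexx ?ler01.
  rewrite (bigD1 ord0)//= mxE eqxx big1 ?addr0// => i i0.
  by rewrite mxE (negbTE i0).
have cF : continuous (fun v : 'rV[R]_M.+1 => \sum_i (h \o clamp) (v ord0 i)).
  apply: (@continuous_sum _ _ _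
    (fun i (v : 'rV[R]_M.+1) => (h \o clamp) (v ord0 i))) => i v.
  apply: (@continuous_comp _ _ _ (fun v : 'rV[R]_M.+1 => v ord0 i) (h \o clamp)).
    exact: coord_continuous.
  exact: h_cont.
have [v] := EVT_min_rV SN cS (continuous_subspaceT cF).
rewrite inE => -[vI v1] vmin.
exists M, (fun i => v ord0 i); split => //.
  by move=> i; have := vI i; rewrite in_itv/= => /andP[].
move=> s s0 s1; have [s' [H1 H2 H3 H4]] := merge_small s0 s1.
apply: le_trans H4.
have cl i : clamp (v ord0 i) = v ord0 i.
  by apply: clampE; have := vI i; rewrite in_itv.
under eq_bigr do rewrite -cl.
have nth_ge0 i : 0 <= nth 0 s' i.
  by have [/(mem_nth 0)/H2//|/(nth_default 0)->] := ltnP i (size s').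
have nth_sum (F : R -> R) : F 0 = 0 ->
    \sum_(i < M.+1) F (nth 0 s' i) = \sum_(x <- s') F x.
  move=> F0; rewrite [RHS](big_nth 0) -(big_mkord xpredT (fun i => F (nth 0 s' i))).
  rewrite (big_cat_nat (n := size s'))//= [X in _ + X]big1_seq ?addr0//.
  by move=> i /andP[_]; rewrite mem_index_iota => /andP[/(nth_default 0)-> _].
pose u : 'rV[R]_M.+1 := \row_i nth 0 s' i.
have uS : S u.
  split; last first.
    rewrite -H3 -(nth_sum id)//; by apply: eq_bigr => i _; rewrite mxE.
  move=> i; rewrite mxE in_itv/= nth_ge0 -H3 -(nth_sum id)//=.
  by rewrite (bigD1 i)//= lerDl sumr_ge0.
have := vmin u; rewrite inE => /(_ uS) /le_trans; apply.
rewrite -nth_sum// le_eqVlt; apply/orP; left; apply/eqP.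
apply: eq_bigr => i _ /=; rewrite clampE ?mxE//.
by have [/(_ i)] := uS; rewrite in_itv mxE.
Qed.

End discrete_minimisation.
(** * Lower bound by duality *)

Section ereal_inf_sums.
Context {R : realType}.
Local Open Scope ereal_scope.

(** Nonnegativity excludes the sum of [+oo] and [-oo]. An infinite infimum, as over an empty set of
    densities or decompositions, makes the bound trivial. *)
Lemma le_ereal_infD (A B : set (\bar R)) (m : R) :
  (forall x, A x -> 0 <= x) -> (forall x, B x -> 0 <= x) ->
  (forall x y, A x -> B y -> m%:E <= x + y) ->
  m%:E <= ereal_inf A + ereal_inf B.
Proof.
move=> A0 B0 H.
have iA : 0 <= ereal_inf A by exact: le_ereal_inf_tmp.
have iB : 0 <= ereal_inf B by exact: le_ereal_inf_tmp.
have [->|Ay] := eqVneq (ereal_inf A) +oo.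
  by rewrite addye ?leey// gt_eqF// (lt_le_trans _ iB).
have [->|By] := eqVneq (ereal_inf B) +oo.
  by rewrite addey ?leey// gt_eqF// (lt_le_trans _ iA).
have fA : ereal_inf A \is a fin_num by rewrite ge0_fin_numE// ltey.
have fB : ereal_inf B \is a fin_num by rewrite ge0_fin_numE// ltey.
apply/lee_addgt0Pr => e e0.
have e2 : (0 < e / 2)%R by rewrite divr_gt0.
have [x Ax xe] := lb_ereal_inf_adherent e2 fA.
have [y By' ye] := lb_ereal_inf_adherent e2 fB.
apply: (le_trans (H _ _ Ax By')).
apply: (le_trans (leeD (ltW xe) (ltW ye))).
by rewrite addeACA -EFinD -splitr.
Qed.

Lemma le_ereal_infD3 (A B C : set (\bar R)) (m : R) :
  (forall x, A x -> 0 <= x) -> (forall x, B x -> 0 <= x) ->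
  (forall x, C x -> 0 <= x) ->
  (forall x y z, A x -> B y -> C z -> m%:E <= x + y + z) ->
  m%:E <= ereal_inf A + ereal_inf B + ereal_inf C.
Proof.
move=> A0 B0 C0 H.
have iA : 0 <= ereal_inf A by exact: le_ereal_inf_tmp.
have iB : 0 <= ereal_inf B by exact: le_ereal_inf_tmp.
(* The sum of two infima is seen as the infimum of a singleton, so that the two-term bound applies
   twice. *)
rewrite -[X in X + ereal_inf C]ereal_inf1; apply: le_ereal_infD => //.
  by move=> _ ->; exact: adde_ge0.
move=> _ z -> Cz; have := C0 z Cz; case: z Cz => [z| |] // Cz z0.
  rewrite -leeBlDr// -EFinB; apply: le_ereal_infD => // x y Ax By.
  by rewrite EFinB leeBlDr// H.
by rewrite addey ?leey// gt_eqF// (lt_le_trans _ (adde_ge0 iA iB)).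
Qed.

End ereal_inf_sums.

(** * Weak duality for a given plan *)

Section lower_bound.
Context {R : realType} {n : nat}.
Variable lam : {measure set (n.-tuple R) -> \bar R}.
Hypothesis lamE : is_lebesgue_n lam.
Hypothesis n0 : (0 < n)%N.
Variable p : R.
Hypothesis p1 : 1 <= p.
Variables f k g : R -> R.
Hypothesis hf : standing_f f.
Hypothesis hk : is_inv_deriv f k.
Hypothesis hg : hyp_g g.
Hypothesis om0 : 0 < omega lam.

Local Notation level := (level lam p k).
Local Notation phi := (phi lam p f k).
Let levP := levelP lamE n0 p1 hf hk om0.
Let hB := profile_legendrep hf hk.

Let f_ge0 t : 0 <= t -> 0 <= f t. Proof. by case: hf => h _; exact: h. Qed.

Section envelope_bounds.
Variables (x : nat -> n.-tuple R) (c : nat -> R).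

(** The potential s(x) of the overview, restricted to the first [M] atoms; starting from [0]
    supplies the positive part. *)
Fixpoint envelope M (y : n.-tuple R) : R :=
  if M is M'.+1 then Num.max (envelope M' y) (tent p (x M') (c M') y) else 0.

Let env0 y : envelope 0 y = 0. Proof. by []. Qed.

Let envS M y : envelope M.+1 y = Num.max (envelope M y) (tent p (x M) (c M) y).
Proof. by []. Qed.

Lemma envelope_ge0 M y : 0 <= envelope M y.
Proof. by elim: M => [|M IH]; rewrite ?env0// envS le_max IH. Qed.

Lemma envelope_ge M y i : (i < M)%N -> tent p (x i) (c i) y <= envelope M y.
Proof.
elim: M => // M IH; rewrite ltnS leq_eqVlt envS le_max => /predU1P[->|/IH ->//].
by rewrite lexx orbT.
Qed.

Lemma measurable_envelope M : measurable_fun setT (envelope M).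
Proof.
elim: M => [|M IH].
  by rewrite (_ : envelope 0 = cst 0)//; apply/funext => y; exact: env0.
rewrite (_ : envelope M.+1 = fun y => Num.max (envelope M y) (tent p (x M) (c M) y)).
  by apply: measurable_maxr => //; exact: measurable_tent.
by apply/funext => y; exact: envS.
Qed.

(** At each point the maximum is [0] or one of the tents, and the other terms are nonnegative. *)
Lemma legendrep_envelope M y :
  legendrep f k (envelope M y) <= \sum_(i < M) legendrep f k (tent p (x i) (c i) y).
Proof.
elim: M => [|M IH]; first by rewrite env0 big_ord0 (profile_le0 hB).
rewrite envS big_ord_recr/=.
have h1 := profile_ge0 hB (envelope M y).
have h2 := profile_ge0 hB (tent p (x M) (c M) y).
case: (leP (envelope M y)) => _; last lra.
by have := le_trans h1 IH; lra.
Qed.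

Lemma young_envelope M (u : n.-tuple R -> R) : measurable_fun setT u ->
  (forall y, 0 <= u y) ->
  (\int[lam]_y ((envelope M y)%:E * (u y)%:E) <=
   \int[lam]_y (f (u y))%:E + (\sum_(i < M) cmass lam p f k (c i))%:E)%E.
Proof.
move=> mu u0.
have mfu : measurable_fun setT (fun y => (f (u y))%:E).
  apply/measurable_EFinP.
  (* [f] is monotone only on nonnegative numbers; the positive part gives a function monotone on the
     whole line, hence measurable. *)
  rewrite (_ : (fun y => f (u y)) = (fun t => f (Num.max t 0)) \o u); last first.
    by apply/funext => y /=; rewrite max_l.
  apply: measurableT_comp mu; apply: nondecreasing_measurable => // s t st.
  apply: (standing_homo hf); first by rewrite le_max lexx orbT.
  by rewrite ge_max !le_max st lexx !orbT.
have mc i : measurable_fun setT (fun y => (legendrep f k (tent p (x i) (c i) y))%:E).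
  exact: measurable_profile.
have msum : measurable_fun setT
    (fun y => (\sum_(i < M) (legendrep f k (tent p (x i) (c i) y))%:E)%E).
  by apply: emeasurable_sum => i.
have -> : ((\sum_(i < M) cmass lam p f k (c i))%:E =
    \int[lam]_y (\sum_(i < M) (legendrep f k (tent p (x i) (c i) y))%:E))%E.
  rewrite ge0_integral_sum//.
    by rewrite -sumEFin; apply: eq_bigr => i _; rewrite massE.
  by move=> i y _; rewrite lee_fin (profile_ge0 hB).
rewrite -ge0_integralD//; last 2 first.
- by move=> y _; rewrite lee_fin f_ge0.
- by move=> y _; apply: sume_ge0 => i _; rewrite lee_fin (profile_ge0 hB).
apply: ge0_le_integral => //.
- by move=> y _; rewrite -EFinM lee_fin mulr_ge0 ?envelope_ge0.
- by apply: emeasurable_funM; apply/measurable_EFinP => //; exact: measurable_envelope.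
- exact: emeasurable_funD.
- move=> y _; rewrite -EFinM sumEFin -EFinD lee_fin.
  have := young hf hk (envelope_ge0 M y) (u0 y).
  by have := legendrep_envelope M y; rewrite /legendrep max_l ?envelope_ge0//; lra.
Qed.

Hypothesis c_ge0 : forall i, 0 <= c i.
Hypothesis x_inj : injective x.

Lemma transport_envelope M (mu nu : probability (n.-tuple R) R)
    (gam : probability (n.-tuple R * n.-tuple R)%type R) :
  transport_plan mu nu gam ->
  (\sum_(i < M) (c i)%:E * nu [set x i] <=
   \int[gam]_z ((edist z.1 z.2) `^ p)%:E + \int[mu]_y (envelope M y)%:E)%E.
Proof.
move=> [g1 g2].
have mx i : measurable [set x i].
  rewrite (_ : [set x i] = box (x i) (x i)); first exact: measurable_box.
  apply/seteqP; split => y /=; first by move=> -> j; rewrite lexx.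
  by move=> h; apply: eq_from_tnth => j; apply/eqP; rewrite eq_le andbC h.
have menv : measurable_fun setT (fun y => (envelope M y)%:E).
  by apply/measurable_EFinP; exact: measurable_envelope.
have -> : (\int[mu]_y (envelope M y)%:E = \int[gam]_z (envelope M z.1)%:E)%E.
  rewrite -(ge0_integral_mpush gam measurable_fst menv); last first.
    by move=> y; rewrite lee_fin envelope_ge0.
  apply: eq_measure_integral => A mA _; apply: (etrans (esym (g1 A mA))).
  congr (gam _); apply/seteqP; split => z //=; first by case.
have -> : (\sum_(i < M) (c i)%:E * nu [set x i] =
    \int[gam]_z (\sum_(i < M) (c i * \1_(setT `*` [set x i]) z)%:E))%E.
  rewrite ge0_integral_sum//.
  - apply: eq_bigr => i _; rewrite -g2//.
    under eq_integral do rewrite EFinM.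
    rewrite ge0_integralZl//.
    + by rewrite integral_indic// ?setIT//; exact: measurableX.
    + by apply/measurable_EFinP; apply: measurable_indic; exact: measurableX.
    + by rewrite lee_fin.
  - move=> i; apply/measurable_EFinP; apply: measurable_funM => //.
    by apply: measurable_indic; exact: measurableX.
  - by move=> i z _; rewrite lee_fin mulr_ge0.
have mdist : measurable_fun setT (fun z : n.-tuple R * n.-tuple R =>
    ((edist z.1 z.2) `^ p)%:E).
  apply/measurable_EFinP; apply: (measurableT_comp (measurable_powR p)).
  exact: measurable_fun_edist.
rewrite -ge0_integralD//; last 3 first.
- by move=> z _; rewrite lee_fin powR_ge0.
- by move=> z _; rewrite lee_fin envelope_ge0.
- exact: (measurableT_comp menv measurable_fst).
apply: ge0_le_integral_nomeas.
- by move=> z _; apply: sume_ge0 => i _; rewrite lee_fin mulr_ge0.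
- move=> [y w] _ /=; rewrite sumEFin -EFinD lee_fin.
  have [[i xi]|nx] := pselect (exists i : 'I_M, w = x i).
    rewrite (bigD1 i)//= indicE mem_set; last by split.
    rewrite mulr1 big1 ?addr0; last first.
      move=> j ji; rewrite indicE memNset ?mulr0// => -[_ /= wj].
      move: ji; rewrite xi in wj; move/x_inj : wj => wj.
      by rewrite (_ : j = i) ?eqxx//; apply: val_inj.
    have := @envelope_ge M y i (ltn_ord i); rewrite /tent xi; lra.
  rewrite big1 => [|i _]; first by rewrite addr_ge0 ?powR_ge0 ?envelope_ge0.
  by rewrite indicE memNset ?mulr0// => -[_ /= wi]; apply: nx; exists i.
Qed.

End envelope_bounds.

Section plan.
Variables (mu nu : probability (n.-tuple R) R).
Variables (gam : probability (n.-tuple R * n.-tuple R)%type R).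
Variables (u : n.-tuple R -> R) (a : nat -> R) (x : nat -> n.-tuple R).
Hypothesis hgam : transport_plan mu nu gam.
Hypothesis hu : is_density lam mu u.
Hypothesis ha : atomic_decomp nu a x.

Let a_ge0 i : 0 <= a i. Proof. by case: ha => h _; exact: h. Qed.

Let nu_atom i : ((a i)%:E <= nu [set x i])%E.
Proof.
case: ha => _ [_ ->]; last first.
  rewrite (_ : [set x i] = box (x i) (x i)); first exact: measurable_box.
  apply/seteqP; split => y /=; first by move=> -> j; rewrite lexx.
  by move=> h; apply: eq_from_tnth => j; apply/eqP; rewrite eq_le andbC h.
apply: le_trans (nneseries_lim_ge i.+1 _); last first.
  by move=> j _ _; rewrite mule_ge0 ?lee_fin.
rewrite big_nat_recr//= diracE mem_set// mule1 leeDr//.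
by apply: sume_ge0 => j _; rewrite mule_ge0 ?lee_fin.
Qed.

(** Taking [c i] to be the level of [a i], the two envelope bounds combine and
    [c i * a i - cmass (c i)] is [phi (a i)]. *)
Lemma plan_lower_bound M :
  ((\sum_(i < M) phi (a i))%:E <=
   \int[gam]_z ((edist z.1 z.2) `^ p)%:E + \int[lam]_y (f (u y))%:E)%E.
Proof.
have [meas_u [u0 uE]] := hu.
have [_ [x_inj _]] := ha.
pose c i := level (a i).
have c0 i : 0 <= c i by have [] := levP (a_ge0 i).
have H1 := transport_envelope c0 x_inj M hgam.
have H2 := @young_envelope x c M u meas_u u0.
rewrite (ge0_integral_density meas_u u0 uE) in H1; last 2 first.
- by apply/measurable_EFinP; exact: measurable_envelope.
- by move=> y; rewrite lee_fin envelope_ge0.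
have H3 : ((\sum_(i < M) c i * a i)%:E <= \sum_(i < M) (c i)%:E * nu [set x i])%E.
  rewrite -sumEFin; apply: lee_sum => i _; rewrite EFinM.
  by apply: lee_wpmul2l; rewrite ?lee_fin// nu_atom.
have -> : \sum_(i < M) phi (a i) = \sum_(i < M) c i * a i - \sum_(i < M) cmass lam p f k (c i).
  by rewrite -sumrB; apply: eq_bigr => i _; rewrite (phiE lamE n0 p1 hf hk om0).
rewrite EFinB leeBlDr//; apply: (le_trans H3); apply: (le_trans H1).
by rewrite -[leRHS]addeA; apply: leeD.
Qed.

Let sum_a : (\sum_(i <oo) (a i)%:E = 1)%E.
Proof.
have [_ [_ h]] := ha; rewrite -(@probability_setT _ _ _ nu) h//.
by apply: eq_eseriesr => i _; rewrite diracT mule1.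
Qed.

Lemma sum_a_le1 M : \sum_(i < M) a i <= 1.
Proof.
rewrite -lee_fin -[(1%:E)%E]sum_a -sumEFin.
rewrite -(big_mkord xpredT (fun i => (a i)%:E)).
by apply: nneseries_lim_ge => i _ _; rewrite lee_fin.
Qed.

Let a_le1 i : a i <= 1.
Proof.
apply: le_trans (sum_a_le1 i.+1); rewrite big_ord_recr/= lerDr.
by apply: sumr_ge0.
Qed.

Let tail_small e : 0 < e -> exists M, 1 - \sum_(i < M) a i < e.
Proof.
move=> e0.
have : ((1 - e)%:E < \sum_(i <oo) (a i)%:E)%E by rewrite sum_a lte_fin; lra.
have -> : (\sum_(i <oo) (a i)%:E)%E = ereal_sup (range (fun M => \sum_(0 <= i < M) (a i)%:E)%E).
  apply/cvg_lim => //; apply: ereal_nondecreasing_cvgn.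
  by apply: ereal_nondecreasing_series => i _ _; rewrite lee_fin.
move=> /ereal_sup_gt[_ [M _ <-]]; rewrite big_mkord sumEFin lte_fin => h.
by exists M; lra.
Qed.

(** The first [M] atoms are completed to unit mass by one atom of mass [tau]; for large [M] its cost
    is at most [e], by continuity at [0]. *)
Lemma total_lower_bound (m0 : R) :
  {for 0, continuous (hcost lam p f k g \o clamp)} -> hcost lam p f k g 0 = 0 ->
  (forall s : seq R, (forall t, t \in s -> 0 <= t) -> \sum_(t <- s) t = 1 ->
    m0 <= \sum_(t <- s) hcost lam p f k g t) ->
  (m0%:E <= \int[gam]_z ((edist z.1 z.2) `^ p)%:E + \int[lam]_y (f (u y))%:E
            + \sum_(i <oo) (g (a i))%:E)%E.
Proof.
move=> hc h0 hm; apply/lee_addgt0Pr => e e0.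
have /cvgrPdist_le/(_ e e0)/nbhs_ballP[d /= d0 hd] := hc.
have [M hM] := tail_small d0.
pose tau := 1 - \sum_(i < M) a i.
have tau0 : 0 <= tau by rewrite subr_ge0 sum_a_le1.
have tau1 : tau <= 1 by rewrite gerBl sumr_ge0.
have htau : hcost lam p f k g tau <= e.
  have /hd : ball (0 : R) d tau by rewrite /ball/= sub0r normrN ger0_norm.
  rewrite !clampE ?lexx ?ler01 ?tau0// h0 sub0r normrN.
  by apply: le_trans; exact: ler_norm.
have := hm (tau :: [seq a (i : 'I_M) | i <- index_enum 'I_M]).
rewrite !big_cons !big_map.
have h1 t : t \in tau :: [seq a (i : 'I_M) | i <- index_enum 'I_M] -> 0 <= t.
  by rewrite inE => /predU1P[->//|/mapP[i _ ->]].
move=> /(_ h1); rewrite /tau subrK -/tau => /(_ erefl).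
rewrite /hcost big_split/= -/(hcost lam p f k g tau) => Hm.
have G1 : ((\sum_(i < M) g (a i))%:E <= \sum_(i <oo) (g (a i))%:E)%E.
  rewrite -sumEFin -(big_mkord xpredT (fun i => (g (a i))%:E)).
  apply: nneseries_lim_ge => i _ _; rewrite lee_fin.
  by case: hg => gg _; apply: gg; rewrite a_ge0 a_le1.
apply: (@le_trans _ _ ((\sum_(i < M) phi (a i))%:E + (\sum_(i < M) g (a i))%:E + e%:E)%E).
  rewrite -!EFinD lee_fin; apply: (le_trans Hm).
  by move: htau; rewrite /hcost; lra.
by apply: leeD => //; apply: leeD => //; exact: plan_lower_bound.
Qed.

End plan.

Theorem frakF_lower_bound (m0 : R) (mu nu : probability (n.-tuple R) R) :
  {for 0, continuous (hcost lam p f k g \o clamp)} -> hcost lam p f k g 0 = 0 ->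
  (forall s : seq R, (forall t, t \in s -> 0 <= t) -> \sum_(t <- s) t = 1 ->
    m0 <= \sum_(t <- s) hcost lam p f k g t) ->
  (m0%:E <= frakF lam f g p mu nu)%E.
Proof.
move=> hc h0 hm; apply: le_ereal_infD3.
- by move=> _ [gam _ <-]; apply: integral_ge0 => z _; rewrite lee_fin powR_ge0.
- move=> _ [u [_ [u0 _]] <-]; apply: integral_ge0 => z _.
  by rewrite lee_fin f_ge0.
- move=> _ [[a x] /= ha <-]; apply: nneseries_ge0 => i _ _; rewrite lee_fin.
  case: hg => gg _; apply: gg.
  have [-> _] := ha; rewrite /=; apply: le_trans (sum_a_le1 ha i.+1).
  rewrite big_ord_recr/= lerDr; apply: sumr_ge0 => j _.
  by have [-> _] := ha.
- move=> _ _ _ [gam hgam <-] [u hu <-] [[a x] /= ha <-].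
  exact: (total_lower_bound hgam hu ha).
Qed.

End lower_bound.

(** * Probability measures built from densities and from maps *)

Section probability_constructions.
Context d d' (T : measurableType d) (U : measurableType d') (R : realType).

Definition pdensity (mu : {measure set T -> \bar R}) (u : T -> R)
    (meas_u : measurable_fun setT u) (u0 : forall x, 0 <= u x)
    (u1 : (\int[mu]_x (u x)%:E = 1)%E) : set T -> \bar R := mdensity mu meas_u u0.

Section pdensity_probability.
Variables (mu : {measure set T -> \bar R}) (u : T -> R).
Variables (meas_u : measurable_fun setT u) (u0 : forall x, 0 <= u x).
Variable u1 : (\int[mu]_x (u x)%:E = 1)%E.

HB.instance Definition _ := Measure.copy (pdensity meas_u u0 u1) (mdensity mu meas_u u0).

Let pdensity_setT : pdensity meas_u u0 u1 setT = 1%E.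
Proof. exact: u1. Qed.

HB.instance Definition _ := @Measure_isProbability.Build _ _ R
  (pdensity meas_u u0 u1) pdensity_setT.

End pdensity_probability.

Definition ppush (P : probability T R) (f : T -> U)
  (mf : measurable_fun setT f) : set U -> \bar R := mpush P mf.

Section ppush_probability.
Variables (P : probability T R) (f : T -> U) (mf : measurable_fun setT f).

HB.instance Definition _ := Measure.copy (ppush P mf) (mpush P mf).

Let ppush_setT : ppush P mf setT = 1%E.
Proof. exact: probability_setT. Qed.

HB.instance Definition _ := @Measure_isProbability.Build _ _ R
  (ppush P mf) ppush_setT.

End ppush_probability.

End probability_constructions.

(** * Construction of the minimiser *)

Section minimiser.
Context {R : realType} {n : nat}.
Variable lam : {measure set (n.-tuple R) -> \bar R}.
Hypothesis lamE : is_lebesgue_n lam.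
Hypothesis n0 : (0 < n)%N.
Variable p : R.
Hypothesis p1 : 1 <= p.
Variables f k g : R -> R.
Hypothesis hf : standing_f f.
Hypothesis hk : is_inv_deriv f k.
Hypothesis hg : hyp_g g.
Hypothesis om0 : 0 < omega lam.

Local Notation level := (level lam p k).
Local Notation phi := (phi lam p f k).
Let levP := levelP lamE n0 p1 hf hk om0.
Let hA := profile_kp hf hk.
Let hB := profile_legendrep hf hk.

Variables (N : nat) (a : 'I_N.+1 -> R).
Hypothesis a_ge0 : forall i, 0 <= a i.
Hypothesis a_sum : \sum_i a i = 1.

Let c i := level (a i).
Let c_ge0 i : 0 <= c i. Proof. by have [] := levP (a_ge0 i). Qed.
(** [rho] is a common bound for the radii of the supports. Since [D] exceeds [2 * rho] and the
    centres lie on the diagonal, the first coordinate alone separates the balls. *)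
Let rho := \sum_i c i + 1.
Let D := rho * 2 + 1.
Let x (i : nat) : n.-tuple R := [tuple i%:R * D | j < n].

Let c_le i : `|c i| + 1 <= rho.
Proof.
by rewrite ger0_norm// lerD2r (bigD1 i)//= lerDl sumr_ge0.
Qed.

Let rho_gt0 : 0 < rho.
Proof. by rewrite ltr_wpDl// sumr_ge0. Qed.

Let D_gt0 : 0 < D.
Proof. by rewrite /D addr_gt0// mulr_gt0. Qed.

Let coord_x i j : tnth (x i) j = i%:R * D.
Proof. by rewrite tnth_mktuple. Qed.

Let separated y i j : edist y (x i) <= rho -> edist y (x j) <= rho -> i = j.
Proof.
move=> /(le_trans (le_coord_edist y (x i) (Ordinal n0))) hi.
move=> /(le_trans (le_coord_edist y (x j) (Ordinal n0))) hj.
move: hi hj; rewrite !coord_x !ler_norml => /andP[i1 i2] /andP[j1 j2].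
have Dp := D_gt0; have rp := rho_gt0.
have DE : D = rho * 2 + 1 by [].
have [ij|ij|//] := ltngtP i j.
- have : i%:R + 1 <= j%:R :> R by rewrite natr1 ler_nat.
  by move=> h; exfalso; have := ler_wpM2r (ltW Dp) h; rewrite mulrDl mul1r; lra.
- have : j%:R + 1 <= i%:R :> R by rewrite natr1 ler_nat.
  by move=> h; exfalso; have := ler_wpM2r (ltW Dp) h; rewrite mulrDl mul1r; lra.
Qed.

Let x_inj : injective x.
Proof.
by move=> i j ij; apply: (@separated (x i)); rewrite ?ij edistxx ltW.
Qed.

(** The transport map: each ball goes to its centre. The balls are disjoint, so the order of the
    tests is immaterial, and the default [x 0] is met only where the density vanishes. *)
Fixpoint tmap M (y : n.-tuple R) : n.-tuple R :=
  if M is M'.+1 then (if edist y (x M') <= rho then x M' else tmap M' y) else x 0.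

Let measurable_tmap M : measurable_fun setT (tmap M).
Proof.
elim: M => [|M IH] /=; first exact: measurable_cst.
apply: measurable_fun_ifT => //.
apply: measurable_fun_ler => //.
exact: (@measurable_fun_edist _ _ _ _ id (cst (x M))).
Qed.

Let tmapE M y i : (i < M)%N -> edist y (x i) <= rho -> tmap M y = x i.
Proof.
elim: M => // M IH iM hi /=; case: ifPn => [h|hN].
  by rewrite (separated h hi).
apply: IH => //; move: iM; rewrite ltnS leq_eqVlt => /predU1P[iM|//].
by move: hN; rewrite -iM hi.
Qed.

Let tmap_range M y : exists2 i, (i <= M)%N & tmap M y = x i.
Proof.
elim: M => [|M [i iM IH]] /=; first by exists 0%N.
case: ifP => _; first by exists M.
by exists i => //; exact: leqW.
Qed.

Arguments tmap : simpl never.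
Local Notation T := (tmap N.+1).
Local Notation t i y := (tent p (x (i : 'I_N.+1)) (c i) y).

(** Reduces each pointwise computation to a single tent. *)
Let active (y : n.-tuple R) : (forall i, t i y <= 0) \/
  exists i : 'I_N.+1, [/\ T y = x i, edist y (x i) <= rho &
                          forall j, j != i -> t j y <= 0].
Proof.
have near i : 0 < t i y -> edist y (x i) <= rho.
  move=> ti; rewrite leNgt; apply/negP => h.
  have := tent_le0 p1 (le_lt_trans (c_le i) h); lra.
have [[i ti]|nt] := pselect (exists i, 0 < t i y); last first.
  by left => i; rewrite leNgt; apply/negP => ti; apply: nt; exists i.
right; exists i; split.
- by apply: tmapE; [exact: ltn_ord|exact: near].
- exact: near.
- move=> j; rewrite leNgt; apply: contra => tj; apply/eqP; apply: val_inj.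
  exact: separated (near _ tj) (near _ ti).
Qed.

Let u y : R := \sum_i kp k (t i y).

Let u_ge0 y : 0 <= u y.
Proof. by apply: sumr_ge0 => i _; exact: (profile_ge0 hA). Qed.

Let measurable_u : measurable_fun setT u.
Proof. by apply: measurable_sum => i; exact: measurable_profileR. Qed.

Let u_int : (\int[lam]_y (u y)%:E = 1)%E.
Proof.
rewrite /u; under eq_integral do rewrite -sumEFin.
rewrite ge0_integral_sum//; last 2 first.
- by move=> i; exact: measurable_profile.
- by move=> i y _; rewrite lee_fin (profile_ge0 hA).
rewrite -[RHS](congr1 EFin a_sum) -sumEFin; apply: eq_bigr => i _.
by rewrite massE//; have [_] := levP (a_ge0 i); rewrite /kmass => ->.
Qed.

Let mu0 : probability (n.-tuple R) R := pdensity measurable_u u_ge0 u_int.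
Let nu0 : probability (n.-tuple R) R := ppush mu0 (measurable_tmap N.+1).

Let measurable_graph : measurable_fun setT (fun y : n.-tuple R => (y, T y)).
Proof. by apply/measurable_fun_pair => //; exact: measurable_tmap. Qed.

Let gam0 : probability (n.-tuple R * n.-tuple R)%type R := ppush mu0 measurable_graph.

Let mu0_density : is_density lam mu0 u.
Proof. by []. Qed.

Let gam0_plan : transport_plan mu0 nu0 gam0.
Proof.
split => A mA.
- rewrite -[LHS]/(mu0 ((fun y => (y, T y)) @^-1` (A `*` setT))).
  by congr (mu0 _); apply/seteqP; split => y //= [].
- rewrite -[LHS]/(mu0 ((fun y => (y, T y)) @^-1` (setT `*` A))).
  by congr (mu0 _); apply/seteqP; split => y //= [].
Qed.

Let mu0_integral (F : n.-tuple R -> \bar R) : measurable_fun setT F ->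
  (forall y, (0 <= F y)%E) -> (\int[mu0]_y F y = \int[lam]_y (F y * (u y)%:E))%E.
Proof. by move=> mF F0; apply: ge0_integral_density. Qed.

Let atoms i : R := if insub i is Some j then a j else 0.

Let atoms_lt (i : 'I_N.+1) : atoms i = a i.
Proof. by rewrite /atoms valK. Qed.

Let atoms_ge i : (N.+1 <= i)%N -> atoms i = 0.
Proof. by move=> h; rewrite /atoms insubN// -leqNgt. Qed.

Let nneseries_atoms (F : nat -> \bar R) : (forall i, (N.+1 <= i)%N -> F i = 0%E) ->
  (\sum_(i <oo) F i = \sum_(i < N.+1) F i)%E.
Proof.
move=> F0; rewrite -(big_mkord xpredT F); apply/cvg_lim => //.
apply: cvg_near_cst; exists N.+1 => // m /= Nm; apply/eqP.
rewrite (big_cat_nat (n := N.+1))//= [X in (_ + X)%E]big1_seq ?adde0//.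
by move=> i /andP[_]; rewrite mem_index_iota => /andP[/F0].
Qed.

Let nu0_atomic : atomic_decomp nu0 atoms x.
Proof.
split; last split => //.
  by move=> i; rewrite /atoms; case: insubP.
move=> A mA; rewrite nneseries_atoms; last first.
  by move=> i /atoms_ge ->; rewrite mul0e.
have mTA : measurable (T @^-1` A).
  by rewrite -[X in measurable X]setTI; exact: measurable_tmap.
rewrite -[LHS]/(\int[lam]_(y in T @^-1` A) (u y)%:E)%E integral_mkcond.
rewrite (_ : (\int[lam]_y _ = \int[lam]_y (\sum_(i < N.+1) (\d_(x i) A * (kp k (t i y))%:E)))%E); last first.
  apply: eq_integral => y _; rewrite patchE.
  have -> : (y \in T @^-1` A) = (T y \in A) by apply/idP/idP; rewrite !inE.
  have [tle|[i [Ti _ tle]]] := active y.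
    rewrite big1 => [|i _]; last by rewrite (profile_le0 hA) ?mule0.
    by rewrite /u big1 ?if_same// => i _; rewrite (profile_le0 hA).
  rewrite (bigD1 i)//= big1 ?adde0 => [|j ji]; last first.
    by rewrite (profile_le0 hA) ?mule0// tle.
  rewrite /u (bigD1 i)//= big1 ?addr0 => [|j ji]; last first.
    by rewrite (profile_le0 hA)// tle.
  by rewrite Ti diracE; case: (_ \in A); rewrite ?mul1e ?mul0e.
rewrite ge0_integral_sum//; last 2 first.
- by move=> i; apply: emeasurable_funM => //; exact: measurable_profile.
- by move=> i y _; rewrite mule_ge0 ?lee_fin ?(profile_ge0 hA).
apply: eq_bigr => i _; rewrite ge0_integralZl//.
- rewrite massE// muleC atoms_lt.
  by have [_] := levP (a_ge0 i); rewrite /kmass => ->.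
- exact: measurable_profile.
- by move=> y _; rewrite lee_fin (profile_ge0 hA).
Qed.

(** A crude bound for the coordinates of the centres and of the support of [u]; it yields finite
    moments of order [p]. *)
Let B0 := N.+1%:R * D + rho.
Let B := Num.sqrt (n%:R * B0 ^+ 2).

Let enorm_le (y : n.-tuple R) : (forall j, `|tnth y j| <= B0) -> enorm y <= B.
Proof.
move=> h; apply: ler_wsqrtr.
rewrite (_ : n%:R * _ = \sum_(j < n) B0 ^+ 2); last first.
  by rewrite sumr_const card_ord mulr_natl.
apply: ler_sum => j _; rewrite -(real_normK (num_real (tnth y j))).
by rewrite lerXn2r ?nnegrE// (le_trans _ (h j)).
Qed.

Let enorm_x i : (i <= N.+1)%N -> enorm (x i) <= B.
Proof.
move=> iN; apply: enorm_le => j; rewrite coord_x ger0_norm; last first.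
  by rewrite mulr_ge0// ltW.
rewrite -[leLHS]addr0 lerD ?(ltW rho_gt0)// ler_wpM2r ?ler_nat//; exact: ltW.
Qed.

Let enorm_support y : u y != 0 -> enorm y <= B.
Proof.
move=> uy; have [tle|[i [_ yi _]]] := active y.
  by move: uy; rewrite /u big1 ?eqxx// => i _; rewrite (profile_le0 hA).
apply: enorm_le => j.
have := le_trans (le_coord_edist y (x i) j) yi; rewrite coord_x => h.
have h2 : `|tnth y j| <= `|tnth y j - i%:R * D| + `|i%:R * D|.
  by rewrite -{1}[tnth y j](subrK (i%:R * D)) ler_normD.
have h3 : `|i%:R * D| <= N.+1%:R * D.
  rewrite ger0_norm ?mulr_ge0 ?(ltW D_gt0)//.
  by rewrite ler_wpM2r ?(ltW D_gt0)// ler_nat ltnW.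
rewrite /B0; lra.
Qed.

Let p_ge0 : 0 <= p. Proof. exact: le_trans p1. Qed.

Let enorm_powR (y : n.-tuple R) : enorm y <= B -> enorm y `^ p <= B `^ p.
Proof.
by move=> h; apply: ge0_ler_powR => //; rewrite nnegrE sqrtr_ge0.
Qed.

Let measurable_enorm_powR :
  measurable_fun setT (fun y : n.-tuple R => ((enorm y) `^ p)%:E).
Proof.
apply/measurable_EFinP; apply: (measurableT_comp (measurable_powR p)).
rewrite (_ : @enorm R n = fun y => edist y [tuple 0 | i < n]); last first.
  by apply/funext => y; exact: enormE.
exact: (@measurable_fun_edist _ _ _ _ id (cst _)).
Qed.

Let mu0_Wp : Wp p mu0.
Proof.
rewrite /Wp mu0_integral//; last by move=> y; rewrite lee_fin powR_ge0.
apply: (@le_lt_trans _ _ (\int[lam]_y ((B `^ p)%:E * (u y)%:E))%E).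
  apply: ge0_le_integral => //.
  - by move=> y _; rewrite -EFinM lee_fin mulr_ge0 ?powR_ge0.
  - by apply: emeasurable_funM => //; exact/measurable_EFinP.
  - by apply: emeasurable_funM => //; exact/measurable_EFinP.
  - move=> y _; rewrite -!EFinM lee_fin.
    have [->|uy] := eqVneq (u y) 0; first by rewrite !mulr0.
    by apply: ler_wpM2r => //; apply: enorm_powR; exact: enorm_support.
rewrite ge0_integralZl//.
- by rewrite u_int mule1 ltry.
- exact/measurable_EFinP.
- by move=> y _; rewrite lee_fin.
- by rewrite lee_fin powR_ge0.
Qed.

Let nu0_Wp : Wp p nu0.
Proof.
rewrite /Wp.
have -> : (\int[nu0]_y ((enorm y) `^ p)%:E = \int[mu0]_y ((enorm (T y)) `^ p)%:E)%E.
  by apply: ge0_integral_mpush => // y; rewrite lee_fin powR_ge0.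
apply: (@le_lt_trans _ _ (\int[mu0]_y (B `^ p)%:E)%E).
  apply: ge0_le_integral => //.
  - by move=> y _; rewrite lee_fin powR_ge0.
  - exact: (measurableT_comp measurable_enorm_powR (measurable_tmap N.+1)).
  - move=> y _; rewrite lee_fin; apply: enorm_powR.
    by have [i iN ->] := tmap_range N.+1 y; exact: enorm_x.
by rewrite integral_cst// [X in (_ * X < _)%E](@probability_setT _ _ _ mu0) mule1 ltry.
Qed.

Let energy y : edist y (T y) `^ p * u y + f (u y) +
  \sum_i legendrep f k (t i y) = \sum_i c i * kp k (t i y).
Proof.
have f0 : f 0 = 0 by case: hf => _ [_ [_ [_ []]]].
have [tle|[i [Ti _ tle]]] := active y.
  have -> : u y = 0 by rewrite /u big1// => i _; rewrite (profile_le0 hA).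
  rewrite mulr0 f0 !add0r !big1// => i _; first by rewrite (profile_le0 hA) ?mulr0.
  by rewrite (profile_le0 hB).
have uE : u y = kp k (t i y).
  rewrite /u (bigD1 i)//= big1 ?addr0// => j ji.
  by rewrite (profile_le0 hA)// tle.
rewrite (bigD1 i)//= big1 ?addr0 => [|j ji]; last by rewrite (profile_le0 hB)// tle.
rewrite [RHS](bigD1 i)//= big1 ?addr0 => [|j ji]; last first.
  by rewrite (profile_le0 hA) ?mulr0// tle.
rewrite uE Ti.
have [ti|ti] := leP (t i y) 0.
  by rewrite (profile_le0 hA)// (profile_le0 hB)// f0 !mulr0 !addr0.
rewrite /kp /legendrep max_l ?(ltW ti)// /legendre.
have -> : edist y (x i) `^ p = c i - t i y by rewrite /tent; ring.
ring.
Qed.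

Let energy_integral :
  (\int[lam]_y (edist y (T y) `^ p * u y)%:E + \int[lam]_y (f (u y))%:E =
   (\sum_i phi (a i))%:E)%E.
Proof.
have f_ge0 s : 0 <= s -> 0 <= f s by case: hf => h _; exact: h.
have mfu : measurable_fun setT (fun y => (f (u y))%:E).
  apply/measurable_EFinP.
  rewrite (_ : (fun y => f (u y)) = (fun s => f (Num.max s 0)) \o u); last first.
    by apply/funext => y /=; rewrite max_l.
  apply: measurableT_comp measurable_u; apply: nondecreasing_measurable => // s s' st.
  apply: (standing_homo hf); first by rewrite le_max lexx orbT.
  by rewrite ge_max !le_max st lexx !orbT.
have mc : measurable_fun setT (fun y => (\sum_i legendrep f k (t i y))%:E).
  by apply/measurable_EFinP; apply: measurable_sum => i; exact: measurable_profileR.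
have mT : measurable_fun setT (fun y => (edist y (T y) `^ p * u y)%:E).
  apply/measurable_EFinP; apply: measurable_funM => //.
  apply: (measurableT_comp (measurable_powR p)).
  exact: (@measurable_fun_edist _ _ _ _ id).
have I1 : (\int[lam]_y (\sum_i legendrep f k (t i y))%:E =
    (\sum_i cmass lam p f k (c i))%:E)%E.
  under eq_integral do rewrite -sumEFin.
  rewrite ge0_integral_sum//.
  - by rewrite -sumEFin; apply: eq_bigr => i _; rewrite massE.
  - by move=> i; exact: measurable_profile.
  - by move=> i y _; rewrite lee_fin (profile_ge0 hB).
have I2 : (\int[lam]_y (\sum_i c i * kp k (t i y))%:E = (\sum_i c i * a i)%:E)%E.
  under eq_integral do rewrite -sumEFin.
  rewrite ge0_integral_sum//.
  - rewrite -sumEFin; apply: eq_bigr => i _.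
    under eq_integral do rewrite EFinM.
    rewrite ge0_integralZl//.
    + by rewrite massE// EFinM; have [_] := levP (a_ge0 i); rewrite /kmass => ->.
    + exact: measurable_profile.
    + by move=> y _; rewrite lee_fin (profile_ge0 hA).
    + by rewrite lee_fin.
  - move=> i; apply/measurable_EFinP; apply: measurable_funM => //.
    exact: measurable_profileR.
  - by move=> i y _; rewrite lee_fin mulr_ge0 ?(profile_ge0 hA).
(* The conjugate terms are added on the left, so that all integrands are nonnegative; their finite
   total is subtracted at the end. *)
have I3 : (\int[lam]_y (edist y (T y) `^ p * u y)%:E + \int[lam]_y (f (u y))%:E
    + (\sum_i cmass lam p f k (c i))%:E = (\sum_i c i * a i)%:E)%E.
  rewrite -I1 -I2 -ge0_integralD//; last 2 first.
  - by move=> y _; rewrite lee_fin mulr_ge0 ?powR_ge0.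
  - by move=> y _; rewrite lee_fin f_ge0.
  rewrite -ge0_integralD//; last 3 first.
  - by move=> y _; rewrite -EFinD lee_fin addr_ge0 ?f_ge0// mulr_ge0 ?powR_ge0.
  - exact: emeasurable_funD.
  - by move=> y _; rewrite lee_fin; apply: sumr_ge0 => i _; exact: (profile_ge0 hB).
  by apply: eq_integral => y _; rewrite -!EFinD energy.
have -> : \sum_i phi (a i) = \sum_i c i * a i - \sum_i cmass lam p f k (c i).
  by rewrite -sumrB; apply: eq_bigr => i _; rewrite (phiE lamE n0 p1 hf hk om0).
by rewrite EFinB -I3 addeK.
Qed.

(** Each of the three terms is an infimum, bounded by its value at [gam0], at [u] and at
    [(atoms, x)] respectively. *)
Theorem frakF_minimiser : exists mu nu : probability (n.-tuple R) R,
  [/\ Wp p mu, Wp p nu &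
    (frakF lam f g p mu nu <= (\sum_i hcost lam p f k g (a i))%:E)%E].
Proof.
exists mu0, nu0; split => //.
rewrite /frakF big_split/= EFinD; apply: leeD; last first.
  apply: ereal_inf_lbound; exists (atoms, x) => //=.
  rewrite nneseries_atoms => [|i /atoms_ge ->]; last first.
    by case: hg => _ [_ [_ [-> _]]].
  by rewrite -sumEFin; apply: eq_bigr => i _; rewrite atoms_lt.
rewrite -energy_integral; apply: leeD; last first.
  by apply: ereal_inf_lbound; exists u.
apply: ereal_inf_lbound; exists gam0 => //.
have md : measurable_fun setT (fun z : n.-tuple R * n.-tuple R =>
    ((edist z.1 z.2) `^ p)%:E).
  apply/measurable_EFinP; apply: (measurableT_comp (measurable_powR p)).
  exact: measurable_fun_edist.
rewrite (_ : (\int[gam0]_z _ = \int[mu0]_y (edist y (T y) `^ p)%:E)%E); last first.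
  by apply: (ge0_integral_mpush mu0 measurable_graph md) => z; rewrite lee_fin powR_ge0.
rewrite mu0_integral//.
- exact: (measurableT_comp md measurable_graph).
- by move=> y; rewrite lee_fin powR_ge0.
Qed.

End minimiser.
Lemma limf_esup_at_right0_lt {R : realType} (u : R -> \bar R) (y : \bar R) :
  (limf_esup u (0%R^'+) < y)%E ->
  exists2 R0, 0 < R0 & forall r, 0 < r < R0 -> (u r < y)%E.
Proof.
move=> /ereal_inf_lt[_ [V /= V0 <-] Vy].
move: V0 => /nbhs_ballP[e /= e0 he]; exists e => // r /andP[r0 re].
apply: le_lt_trans Vy; apply: ereal_sup_ubound; exists r => //.
by apply: he => //=; rewrite /ball/= sub0r normrN gtr0_norm.
Qed.

Theorem theorem4p6 (R : realType) (n : nat) (p : R)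
    (lam : {measure set (n.-tuple R) -> \bar R}) (f k g : R -> R) :
  (0 < n)%N -> is_lebesgue_n lam -> 1 <= p ->
  standing_f f -> C2_pos f -> is_inv_deriv f k ->
  hyp_g g ->
  (limf_esup (fun Rad : R =>
      ((derive1n 2 g (fine (radial_int n (omega lam) p k Rad)))%:E *
       radial_int n (omega lam) p (derive1 k) Rad)%E) (0%R^'+) < (-1)%:E)%E ->
  exists mu0 nu0 : probability (n.-tuple R) R,
    Wp p mu0 /\ Wp p nu0 /\
    forall mu nu : probability (n.-tuple R) R, Wp p mu -> Wp p nu ->
      (frakF lam f g p mu0 nu0 <= frakF lam f g p mu nu)%E.
Proof.
move=> n0 lamE p1 hf _ hk hg /limf_esup_at_right0_lt[R0 R00 HR].
have om0 := omega_gt0 R00 HR.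
have hc := hcost_clamp_continuous lamE n0 p1 hf hk hg R00 HR.
have h0 := hcost0 lamE n0 p1 hf hk hg R00 HR.
have [d d0 hsub] := hcost_subadditive lamE n0 p1 hf hk hg R00 HR.
have [N [a [a0 a1 amin]]] := discrete_min h0 hc d0 hsub.
have [mu0 [nu0 [hmu hnu hle]]] := frakF_minimiser lamE n0 p1 hf hk hg om0 a0 a1.
exists mu0, nu0; split => //; split => // mu nu _ _.
apply: (le_trans hle).
exact: (frakF_lower_bound lamE n0 p1 hf hk hg om0 mu nu (hc 0) h0 amin).
Qed.
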